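(* Lagarias' conjecture is false in general. Namely, there exists a slowly increasing complex measure $\mu$ on $\mathbb{R}^2$ such that $\operatorname{supp}\mu$ is uniformly discrete, the Fourier transform $\hat\mu$ is also a measure with uniformly discrete support, and yet $\operatorname{supp}\mu$ is not contained in any finite union of translates of a single full-rank lattice; that is, there do not exist a full-rank lattice $L\subset\mathbb{R}^2$ and finitely many points $a_1,\dots,a_N\in\mathbb{R}^2$ with $\operatorname{supp}\mu\subset\bigcup_{j=1}^N (L+a_j)$.
   Context: A complex measure $\mu$ on $\mathbb{R}^p$ (locally finite) is slowly increasing if its variation satisfies $|\mu|(\{|x|<R\})=O(R^M)$ as $R\to\infty$ for some $M<\infty$; such a $\mu$ defines a tempered distribution. Its Fourier transform $\hat\mu$ is the tempered distribution defined by $\hat\mu(f)=\mu(\hat f)$ for all Schwartz functions $f$, where $\hat f(y)=\int_{\mathbb{R}^p} f(x)e^{-2\pi i\langle x,y\rangle}\,dx$. Saying that $\hat\mu$ is a measure means that this distribution is given by a complex measure. A set $S\subset\mathbb{R}^p$ is uniformly discrete if there is $\gamma>0$ with $|x-x'|\ge\gamma$ for all distinct $x,x'\in S$. A full-rank lattice in $\mathbb{R}^p$ is a set $L=A(\mathbb{Z}^p)$ with $A$ a non-degenerate linear operator on $\mathbb{R}^p$. Lagarias' conjecture asserts that if $\mu$ is a complex measure on $\mathbb{R}^p$ with uniformly discrete support and $\hat\mu$ is also a measure with uniformly discrete support, then $\operatorname{supp}\mu$ is a subset of a finite union of translates of some full-rank lattice. *)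

(* Defs.v *)
From HB Require Import structures.
From mathcomp Require Import all_boot all_order all_algebra.
From mathcomp Require Import all_classical all_reals all_analysis.
From mathcomp Require Export complex.
Set Implicit Arguments.
Unset Strict Implicit.
Unset Printing Implicit Defensive.

Import Order.TTheory GRing.Theory Num.Theory.
Import numFieldNormedType.Exports.
Import ComplexField.Normc.

Local Open Scope classical_set_scope.
Local Open Scope ring_scope.

(* A copy of [R * R] carrying its Borel (product) sigma-algebra. *)
Notation plane R := (measurableTypeR R * measurableTypeR R)%type.

Section plane.
Context {R : realType}.
Implicit Types x y : R * R.

(* Euclidean structure; the library norm of [R * R] is the sup norm. *)
Definition dotp x y : R := x.1 * y.1 + x.2 * y.2.

Definition enorm x : R := Num.sqrt (dotp x x).

Definition eball x (r : R) : set (plane R) := [set y : R * R | enorm (y - x) < r].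

Definition bounded (A : set (plane R)) := exists r : R, A `<=` eball 0 r.

Definition uniformly_discrete (S : set (R * R)) :=
  exists2 g : R, 0 < g &
    forall x y, S x -> S y -> x <> y -> g <= enorm (x - y).

Definition integer_points : set (R * R) :=
  [set z | exists m n : int, z = (m%:~R, n%:~R)].

Definition full_rank_lattice (L : set (R * R)) :=
  exists A : {linear (R * R)%type -> (R * R)%type},
    injective A /\ L = A @` integer_points.

Definition translates (L : set (R * R)) (s : seq (R * R)) : set (R * R) :=
  [set x | exists2 a, a \in s & exists2 l, L l & x = l + a].
End plane.

Section additivity.
Context {R : realType} {K : numFieldType} {V : normedModType K}.

(* Countable additivity is required for sets with bounded union only; the
   values on unbounded sets are irrelevant. *)
Definition locally_sigma_additive (nu : set (plane R) -> V) :=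
  forall F : (set (plane R))^nat,
    (forall n, measurable (F n)) -> trivIset setT F ->
    bounded (\bigcup_n F n) ->
    (fun n => \sum_(0 <= i < n) nu (F i)) @ \oo --> nu (\bigcup_n F n).
End additivity.

Record signed_measure (R : realType) := SignedMeasure {
  sm_val :> set (plane R) -> R;
  sm_additive : locally_sigma_additive sm_val }.

Record complex_measure (R : realType) := ComplexMeasure {
  cm_val :> set (plane R) -> R[i];
  cm_additive : locally_sigma_additive (cm_val : set (plane R) -> R[i]^o) }.

Section upper_variation.
Context {R : realType} (nu : signed_measure R).
Local Open Scope ereal_scope.

Definition upper_variation (A : set (plane R)) : \bar R :=
  ereal_sup [set (nu B)%:E | B in
    [set B | [/\ measurable B, bounded B & B `<=` A]]].

Lemma bounded0 : bounded (set0 : set (plane R)).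
Proof. by exists 0%R. Qed.

Lemma bounded_sub (A B : set (plane R)) : A `<=` B -> bounded B -> bounded A.
Proof. by move=> AB [r Br]; exists r; exact: subset_trans Br. Qed.

Lemma boundedU (A B : set (plane R)) :
  bounded A -> bounded B -> bounded (A `|` B).
Proof.
move=> [r Ar] [s Bs]; exists (Num.max r s) => x [/Ar|/Bs]; rewrite /eball/= => h;
by rewrite lt_max h ?orbT.
Qed.

Lemma signed_measure0 : nu set0 = 0%R.
Proof.
have /= h := @sm_additive _ nu (fun=> set0).
have {h} : (fun n => \sum_(0 <= i < n) nu set0)%R @ \oo --> nu set0.
  rewrite -[X in _ --> nu X](@bigcup0 _ nat setT (fun=> set0))//; apply: h => //.
  - exact: trivIset_set0.
  - by rewrite bigcup0//; exact: bounded0.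
move=> h.
have h1 : (fun n => \sum_(0 <= i < n.+1) nu set0)%R @ \oo --> nu set0.
  by move: h; rewrite -(cvg_shiftS (fun n => \sum_(0 <= i < n) nu set0)%R).
have : (fun n => \sum_(0 <= i < n.+1) nu set0 - \sum_(0 <= i < n) nu set0)%R
     @ \oo --> (nu set0 - nu set0)%R by exact: cvgB.
rewrite subrr.
under eq_cvg do rewrite big_nat_recr//= addrAC subrr add0r.
by move/cvg_lim => <- //; rewrite lim_cst.
Qed.

Lemma signed_measureU (A B : set (plane R)) :
  measurable A -> measurable B -> bounded A -> bounded B ->
  A `&` B = set0 -> nu (A `|` B) = (nu A + nu B)%R.
Proof.
move=> mA mB bA bB AB.
have := @sm_additive _ nu (bigcup2 A B).
rewrite bigcup2E => /(_ _ _ (boundedU bA bB)) h.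
have {h} : (fun n => \sum_(0 <= i < n) nu (bigcup2 A B i))%R @ \oo
    --> nu (A `|` B).
  apply: h; first by case=> [//|[//|n]]; exact: measurable0.
  by rewrite -trivIset_bigcup2.
rewrite -(cvg_shiftn 2) => h; apply/esym.
rewrite -(cvg_lim _ h)//; apply/esym/cvg_lim => //.
apply: cvg_near_cst; near=> n.
rewrite /= addn2 big_nat_recl// big_nat_recl//= big1 ?addr0// => i _.
exact: signed_measure0.
Unshelve. all: by end_near. Qed.

Let upper0 : upper_variation set0 = 0.
Proof.
rewrite /upper_variation; apply/eqP; rewrite eq_le; apply/andP; split.
  apply: ge_ereal_sup => _ [B [_ _ B0] <-]; move: B0; rewrite subset0 => ->.
  by rewrite signed_measure0.
apply: ereal_sup_ubound; exists set0; rewrite ?signed_measure0//.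
by split => //; exact: bounded0.
Qed.

Let upper_ge0 A : 0 <= upper_variation A.
Proof.
apply: ereal_sup_ubound; exists set0; rewrite ?signed_measure0//.
by split => //; exact: bounded0.
Qed.

Let le_upper A B : A `<=` B -> upper_variation A <= upper_variation B.
Proof.
move=> AB; apply: ereal_sup_le => _ [C [mC bC CA] <-].
by exists C => //; split => //; exact: subset_trans AB.
Qed.

Let upperU A B : A `&` B = set0 ->
  upper_variation A + upper_variation B <= upper_variation (A `|` B).
Proof.
move=> AB.
have [->|fin] := eqVneq (upper_variation (A `|` B)) +oo; first exact: leey.
have ffin C : C `<=` A `|` B -> upper_variation C \is a fin_num.
  move=> CAB; rewrite ge0_fin_numE//.
  by rewrite (le_lt_trans (le_upper CAB))// ltey.
have fA : upper_variation A \is a fin_num by apply: ffin; exact: subsetUl.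
have fB : upper_variation B \is a fin_num by apply: ffin; exact: subsetUr.
rewrite -leeBrDr//; apply: ge_ereal_sup => _ [C [mC bC CA] <-].
rewrite leeBrDr// addeC -leeBrDr//.
apply: ge_ereal_sup => _ [D [mD bD DB] <-].
rewrite leeBrDr// -EFinD; apply: ereal_sup_ubound; exists (D `|` C).
  split; [exact: measurableU|exact: boundedU|].
  by rewrite setUC; exact: setUSS.
rewrite signed_measureU//; apply/seteqP; split => // x [/DB Bx /CA Ax].
by rewrite -AB.
Qed.

Let upper_sigma_additive : semi_sigma_additive upper_variation.
Proof.
move=> F mF tF mUF.
have cF : cvgn (fun n => \sum_(0 <= i < n) upper_variation (F i)).
  by apply: is_cvg_ereal_nneg_natsum => i _; exact: upper_ge0.
suff -> : upper_variation (\bigcup_n F n) =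
    \sum_(0 <= i <oo) upper_variation (F i) by [].
apply/eqP; rewrite eq_le; apply/andP; split.
  apply: ge_ereal_sup => _ [B [mB bB BF] <-].
  have BE : B = \bigcup_n (B `&` F n) by rewrite -setI_bigcupr; exact/esym/setIidl.
  have /= := @sm_additive _ nu (fun n => B `&` F n).
  rewrite -BE => /(_ _ _ bB) h.
  have {h} : (fun n => \sum_(0 <= i < n) nu (B `&` F i))%R @ \oo --> nu B.
    apply: h; first by move=> n; exact: measurableI.
    exact: trivIset_setIl.
  move=> h; have hE : (fun n => (\sum_(0 <= i < n) nu (B `&` F i))%R%:E) @ \oo
      --> (nu B)%:E by exact: (cvg_comp _ _ h).
  rewrite -(cvg_lim _ hE)//; apply: lee_lim => //.
    by apply/cvg_ex; exists (nu B)%:E.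
  near=> n; rewrite -sumEFin; apply: lee_sum => i _.
  apply: ereal_sup_ubound; exists (B `&` F i) => //; split => //.
  - exact: measurableI.
  - exact: bounded_sub bB.
apply: lime_le => //; near=> n; rewrite big_mkord.
apply: (@le_trans _ _ (upper_variation (\big[setU/set0]_(i < n) F i))); last first.
  by apply: le_upper; exact: bigsetU_bigcup.
elim: (n) => [|m ih]; first by rewrite !big_ord0 upper0.
rewrite !big_ord_recr/=; apply: le_trans; last first.
  apply: upperU; rewrite setIC; apply/seteqP; split => // x [Fx].
  rewrite -bigcup_mkord => -[i /= im Fix].
  have := tF m i I I; move=> /(_ (ex_intro _ x (conj Fx Fix))) mi.
  by rewrite mi ltnn in im.
exact: leeD2r.
Unshelve. all: by end_near. Qed.

HB.instance Definition _ := isMeasure.Build _ _ _ upper_variation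
  upper0 upper_ge0 upper_sigma_additive.
End upper_variation.

Section parts.
Context {R : realType}.

Let cvg_part (p : R[i] -> R) (u : nat -> R[i]^o) (l : R[i]^o) :
  (forall z w, p (z - w) = p z - p w) -> (forall z, `|p z| <= normc z) ->
  u @ \oo --> l -> (p \o u) @ \oo --> p l.
Proof.
move=> pB pn /cvgrPdist_lt ul; apply/cvgrPdist_lt => e e0.
have e0' : (0 : R[i]) < e%:C%C by rewrite ltcR.
have := ul _ e0'; apply: filterS => n /=.
rewrite -pB; have -> : `|l - u n| = (normc (l - u n))%:C%C by [].
by rewrite ltcR; exact/le_lt_trans/pn.
Qed.

Let part_additive (p : R[i] -> R) (mu : complex_measure R) :
  (forall z w, p (z - w) = p z - p w) -> (forall z, `|p z| <= normc z) ->
  locally_sigma_additive (p \o mu).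
Proof.
move=> pB pn F mF tF bF.
have p0 : p 0 = 0 by rewrite -(subrr (0 : R[i])) pB subrr.
have pD z w : p (z + w) = p z + p w.
  by rewrite -[w in LHS]opprK pB -[- w]sub0r pB p0 sub0r opprK.
rewrite (_ : (fun n => _) = p \o (fun n => \sum_(0 <= i < n) mu (F i))).
  exact: (cvg_part pB pn (cm_additive mF tF bF)).
by apply/funext => n /=; rewrite (big_morph p pD p0).
Qed.

Let Re_additive (mu : complex_measure R) :
  locally_sigma_additive (@complex.Re R \o mu).
Proof.
apply: part_additive => [[a b] [c d]//|[a b]] /=.
by rewrite -sqrtr_sqr ler_wsqrtr// lerDl sqr_ge0.
Qed.

Let Im_additive (mu : complex_measure R) :
  locally_sigma_additive (@complex.Im R \o mu).
Proof.
apply: part_additive => [[a b] [c d]//|[a b]] /=.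
by rewrite -sqrtr_sqr ler_wsqrtr// lerDr sqr_ge0.
Qed.

Let opp_additive (nu : signed_measure R) : locally_sigma_additive (- (nu : _ -> R)).
Proof.
move=> F mF tF bF; rewrite [X in X @ _ --> _](_ : _ =
    fun n => - \sum_(0 <= i < n) nu (F i)).
  by apply: cvgN; exact: sm_additive.
by apply/funext => n; rewrite -sumrN.
Qed.

Definition Re_measure mu := SignedMeasure (@Re_additive mu).
Definition Im_measure mu := SignedMeasure (@Im_additive mu).
Definition opp_measure nu := SignedMeasure (@opp_additive nu).
End parts.

Section complex_measures.
Context {R : realType}.
Implicit Types (mu : complex_measure R) (f : R * R -> R[i]).

(* Partitions into bounded sets, on which [mu] is meaningful, give the usual
   variation of unbounded sets as well. *)
Definition bounded_partition (A : set (plane R)) (F : (set (plane R))^nat) :=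
  [/\ forall n, measurable (F n), forall n, bounded (F n),
      trivIset setT F & \bigcup_n F n = A].

Definition complex_variation mu (A : set (plane R)) : \bar R :=
  ereal_sup [set (\sum_(0 <= n <oo) (normc (mu (F n)))%:E)%E | F in
    bounded_partition A].

Definition supp mu : set (R * R) :=
  [set x | forall r, 0 < r -> (0 < complex_variation mu (eball x r))%E].

Definition slowly_increasing mu :=
  exists M C : R, \forall r \near +oo,
    (complex_variation mu (eball 0%R r) <= (C * r `^ M)%:E)%E.

Definition integralC (m : {measure set (plane R) -> \bar R}) f : R[i] :=
  ((\int[m]_x complex.Re (f x)) +i* (\int[m]_x complex.Im (f x)))%C.

(* Jordan decomposition: the lower variation of [nu] is the upper variation
   of [- nu]. *)
Definition integral_signed (nu : signed_measure R) f : R[i] :=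
  integralC (upper_variation nu) f -
  integralC (upper_variation (opp_measure nu)) f.

Definition integral_complex mu f : R[i] :=
  integral_signed (Re_measure mu) f + 'i%C * integral_signed (Im_measure mu) f.
End complex_measures.

Section tempered.
Context {R : realType}.
Implicit Types (mu : complex_measure R) (T : (R * R -> R[i]) -> R[i]).

Definition partial_derivative (a b : nat) (g : R * R -> R) : R * R -> R :=
  iter a (fun h x => 'D_(1 : R, 0 : R) h x)
    (iter b (fun h x => 'D_(0 : R, 1 : R) h x) g).

(* Differentiability of all the derivatives taken in this order makes mixed
   derivatives symmetric, so that the order is immaterial. *)
Definition schwartz_real (g : R * R -> R) := forall a b : nat,
  (forall x, differentiable (partial_derivative a b g) x) /\
  (forall j k : nat, exists C : R, forall x,
     `|x.1 ^+ j * x.2 ^+ k * partial_derivative a b g x| <= C).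

Definition schwartz (f : R * R -> R[i]) :=
  schwartz_real (@complex.Re R \o f) /\ schwartz_real (@complex.Im R \o f).

Definition cis (t : R) : R[i] := (cos t +i* sin t)%C.

Definition fourier (f : R * R -> R[i]) (y : R * R) : R[i] :=
  integralC (@lebesgue_measure R \x @lebesgue_measure R)%E
    (fun x => f x * cis (- (2 * trigo.pi * dotp x y))).

(* Distributions are plain functionals here; their values are meaningful for
   Schwartz functions only. *)
Definition distribution_of mu : (R * R -> R[i]) -> R[i] := integral_complex mu.

Definition fourier_distribution T : (R * R -> R[i]) -> R[i] :=
  fun f => T (fourier f).

(* Slow increase of [nu] amounts to the [nu]-integrability of all Schwartz
   functions. *)
Definition given_by T (nu : complex_measure R) :=
  slowly_increasing nu /\ forall f, schwartz f -> T f = distribution_of nu f.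
End tempered.

(* Main.v *)
Require Import Defs.
From mathcomp Require Import all_boot all_order all_algebra.
From mathcomp Require Import all_classical all_reals all_analysis.
From mathcomp Require Import measurable_realfun.
From mathcomp Require Import zify ring lra.
Set Implicit Arguments.
Unset Strict Implicit.
Unset Printing Implicit Defensive.
Import Order.TTheory GRing.Theory Num.Theory.
Import numFieldNormedType.Exports.
Local Open Scope classical_set_scope.
Local Open Scope ring_scope.

(* Put unit masses at the points (m, 2n) and masses (-1)^n at the points
   (sqrt 2 m, 2n + 1), for all integers m and n.  The even rows form a lattice;
   the odd ones form a translated lattice, weighted by a character.  By Poisson
   summation the Fourier transform of the first part is carried by
   (m, n / 2), and that of the second by (m / sqrt 2, n / 2 + 1 / 4): the
   character shifts the dual lattice vertically by 1/4, which keeps its rows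
   apart from those of the first part, so that the union is again uniformly
   discrete.  If finitely many translates of one lattice L covered the support,
   then two points (m, 0), and likewise two points (sqrt 2 m, 1), would lie in
   the same translate; L would contain (d, 0) and (sqrt 2 d', 0) with nonzero
   integers d and d', which forces sqrt 2 to be rational.

   Poisson summation is proved in the form of convergence of symmetric partial
   sums: the partial sums of the Fourier transform are integrals against a
   Dirichlet kernel, which localise at the lattice points by the
   Riemann-Lebesgue lemma. *)

(** * Integration of functions dominated by [weight] *)

Section decay.
Context {R : realType}.
Notation mR := (measurableTypeR R).
Notation mu := (@lebesgue_measure R).
Implicit Types (C x y : R) (h : R -> R).

(** Domination by [weight] in each coordinate is the common currency: [weight] is integrable and
    changes by a bounded factor over unit distances, so it controls integrals and lattice sums
    alike. For the Fourier transform of a Schwartz function, measurability and domination by a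
    product of weights are what gets established; they identify its integral against a discrete
    measure with a limit of sums over boxes. Poisson summation then enters as the existence of a
    common limit of two families of box sums, one for each side.

    The localisation compares a function with the step function that takes its value at the nearest
    lattice point. On the step function the Dirichlet kernel acts exactly, by orthogonality on each
    cell. The remainder vanishes at the lattice points, which cancels the zeros of the sine in the
    denominator of the kernel and leaves a bounded function times a fast sine. All computations are
    real: complex exponentials enter as cosines with phases [0] and [pi / 2]. *)

Definition weight x : R := (1 + x ^+ 2)^-1.

Lemma weight_gt0 x : 0 < weight x.
Proof. by rewrite invr_gt0 ltr_pwDl// sqr_ge0. Qed.

Lemma weight_ge0 x : 0 <= weight x. Proof. exact/ltW/weight_gt0. Qed.

Lemma weightN x : weight (- x) = weight x.
Proof. by rewrite /weight sqrrN. Qed.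

Lemma weight_le x y k : 0 <= k -> 1 + x ^+ 2 <= k * (1 + y ^+ 2) ->
  weight y <= k * weight x.
Proof.
move=> k0 xy; rewrite /weight ler_pdivlMr; last by rewrite ltr_pwDl// sqr_ge0.
by rewrite mulrC ler_pdivrMr// ltr_pwDl// sqr_ge0.
Qed.

(** Because [(y + d) ^+ 2 <= 2 * y ^+ 2 + 2]. The factor 3 reappears in later constants whenever a
    point is replaced by a translate, by the nearest lattice point or by an intermediate point. *)
Lemma weight_near x y : `|x - y| <= 1 -> weight y <= 3 * weight x.
Proof.
move=> /ler_normlP[]; set d := x - y => d1 d2; apply: weight_le => //.
have -> : x = y + d by rewrite /d; ring.
have : d ^+ 2 <= 1 by nra.
nra.
Qed.

Lemma integrable_weight : mu.-integrable setT (EFin \o weight).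
Proof.
have cw : continuous weight by exact: continuous_oneDsqrV.
apply/integrableP; split.
  by apply/measurable_EFinP; exact: continuous_measurable_fun.
rewrite [ltLHS](_ : _ = (\int[mu]_x (weight x)%:E)%E); last first.
  by apply: eq_integral => x _; rewrite gee0_abs// lee_fin weight_ge0.
rewrite ge0_symfun_integralT//; [|exact: weight_ge0|by move=> x; rewrite /= weightN].
rewrite [X in (_ * X)%E](_ : _ = (pi / 2)%:E) ?ltry//.
rewrite -integral0y_oneDsqr; congr integral.
by apply/seteqP; split => x /=; rewrite in_itv/= andbT.
Qed.

Definition Int h : R := \int[mu]_x h x.

(** The constant is explicit so that a whole sequence can share one integrable bound, as dominated
    convergence requires. *)
Definition dom C h := measurable_fun (setT : set mR) (h : mR -> mR) /\
  forall x, `|h x| <= C * weight x.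

Lemma dom_integrable C h : dom C h -> mu.-integrable setT (EFin \o h).
Proof.
move=> [mh hC]; apply: (@le_integrable _ _ _ mu _ _ _ (EFin \o (fun x => C * weight x))) => //.
- exact/measurable_EFinP.
- by move=> x _ /=; rewrite lee_fin (le_trans (hC x))// ler_norm.
- exact: (integrableZl measurableT C integrable_weight).
Qed.

Lemma dom_weight : dom 1 weight.
Proof.
split; first by apply: continuous_measurable_fun; exact: continuous_oneDsqrV.
by move=> x; rewrite mul1r ger0_norm// weight_ge0.
Qed.

Lemma Int_weight_ge0 : 0 <= Int weight.
Proof. by apply: Rintegral_ge0 => x _; exact: weight_ge0. Qed.

Lemma dom_ge0 C h : dom C h -> 0 <= C.
Proof.
move=> [_ /(_ 0)]; rewrite /weight expr0n/= addr0 invr1 mulr1.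
exact: le_trans.
Qed.

Lemma IntZ C h k : dom C h -> Int (fun x => k * h x) = k * Int h.
Proof. by move=> /dom_integrable; exact: RintegralZl. Qed.

Lemma IntZr C h k : dom C h -> Int (fun x => h x * k) = Int h * k.
Proof. by move=> /dom_integrable; exact: RintegralZr. Qed.

Lemma IntD C C' h h' : dom C h -> dom C' h' ->
  Int (fun x => h x + h' x) = Int h + Int h'.
Proof. by move=> /dom_integrable ? /dom_integrable ?; exact: RintegralD. Qed.

Lemma IntB C C' h h' : dom C h -> dom C' h' ->
  Int (fun x => h x - h' x) = Int h - Int h'.
Proof. by move=> /dom_integrable ? /dom_integrable ?; exact: RintegralB. Qed.

Lemma Int0 : Int (fun=> 0) = 0.
Proof. by rewrite /Int /Rintegral integral0. Qed.

Lemma le_Int C C' h h' : dom C h -> dom C' h' -> (forall x, h x <= h' x) ->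
  Int h <= Int h'.
Proof. by move=> /dom_integrable ? /dom_integrable ? hh; exact: le_Rintegral. Qed.

Lemma dom_norm C h : dom C h -> dom C (fun x => `|h x|).
Proof.
move=> [mh hC]; split; last by move=> x; rewrite normr_id.
exact: measurableT_comp.
Qed.

Lemma normr_Int C h : dom C h -> `|Int h| <= Int (fun x => `|h x|).
Proof. by move=> /dom_integrable ?; exact: le_normr_Rintegral. Qed.

Lemma Int_le C h : dom C h -> `|Int h| <= C * Int weight.
Proof.
move=> hC; rewrite (le_trans (normr_Int hC))// -(IntZ C dom_weight).
apply: (le_Int (dom_norm hC)) (hC.2); split.
  by apply: measurable_funM => //; exact: dom_weight.1.
move=> x; rewrite normrM (ger0_norm (weight_ge0 x)) (ger0_norm (dom_ge0 hC))//.
Qed.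

Lemma domM C D h k : dom C h -> measurable_fun setT (k : mR -> mR) ->
  (forall x, `|k x| <= D) -> dom (C * D) (fun x => h x * k x).
Proof.
move=> [mh hC] mk kD; split; first exact: measurable_funM.
move=> x; rewrite normrM mulrAC ler_pM//.
Qed.

Lemma domD C D h k : dom C h -> dom D k -> dom (C + D) (fun x => h x + k x).
Proof.
move=> [mh hC] [mk kD]; split; first exact: measurable_funD.
by move=> x; rewrite (le_trans (ler_normD _ _))// mulrDl lerD.
Qed.

Lemma domB C D h k : dom C h -> dom D k -> dom (C + D) (fun x => h x - k x).
Proof.
move=> [mh hC] [mk kD]; split; first exact: measurable_funB.
by move=> x; rewrite (le_trans (ler_normB _ _))// mulrDl lerD.
Qed.

(** The exceptional set [A] will be the set of lattice points, where [quotient] has the default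
    value of a division by zero and is not the limit of its translates. *)
Lemma Int_cvg C (u : nat -> R -> R) h (A : set R) : (forall n, dom C (u n)) ->
  measurable_fun (setT : set mR) (h : mR -> mR) -> countable A ->
  (forall x, ~ A x -> u n x @[n --> \oo] --> h x) ->
  Int (u n) @[n --> \oo] --> Int h.
Proof.
move=> uC mh cA uh.
have [|||||ih _] := @dominated_convergence _ mR R mu setT measurableT
  (fun n => EFin \o u n) (EFin \o h) (EFin \o (fun x => C * weight x)).
- by move=> n; apply/measurable_EFinP; exact: (uC n).1.
- exact/measurable_EFinP.
- exists A; split => [||x/= nux]; last first.
  + by apply: contrapT => Ax; apply: nux => _; exact: (cvg_comp _ _ (uh x Ax)).
  + exact: countable_lebesgue_measure0.
  + exact: countable_measurable.
- exact: (integrableZl measurableT C integrable_weight).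
- by apply: aeW => x n _ /=; rewrite lee_fin; exact: (uC n).2.
move=> H; rewrite -[X in _ --> X]/(fine _); apply: fine_cvg.
rewrite fineK; last exact: integrable_fin_num.
exact: H.
Qed.

Lemma Int_cvgT C (u : nat -> R -> R) h : (forall n, dom C (u n)) ->
  (forall x, u n x @[n --> \oo] --> h x) ->
  dom C h /\ Int (u n) @[n --> \oo] --> Int h.
Proof.
move=> uC uh.
have mh : measurable_fun (setT : set mR) (h : mR -> mR).
  apply: (@measurable_fun_cvg _ mR R setT u h).
    by move=> n; exact: (uC n).1.
  by move=> x _; exact: uh.
split; last by apply: (Int_cvg uC mh (countable0 _)) => x _; exact: uh.
split=> // x; have ucvg : `|u n x| @[n --> \oo] --> `|h x| by exact: cvg_norm.
rewrite -(cvg_lim _ ucvg)//; apply: limr_le; first by apply/cvg_ex; eexists; exact: ucvg.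
by apply: nearW => n; exact: (uC n).2.
Qed.

Lemma dom_shift C h d : `|d| <= 1 -> dom C h -> dom (3 * C) (fun x => h (x + d)).
Proof.
move=> d1 hC; have C0 := dom_ge0 hC; case: hC => mh hC; split.
  by apply: (measurableT_comp mh); exact: measurable_funD.
move=> x; rewrite (le_trans (hC _))// [3 * C]mulrC -mulrA ler_wpM2l//.
by rewrite weight_near// opprD addrA subrr sub0r normrN.
Qed.

Lemma lebesgue_measure_shift d (A : set mR) : measurable A ->
  mu A = mu ((+%R^~ d) @^-1` A).
Proof.
move=> mA; have mf : measurable_fun (setT : set mR) ((+%R^~ d) : mR -> mR).
  exact: measurable_funD.
rewrite -[RHS]/(pushforward mu (+%R^~ d) A).
apply: (@lebesgue_measure_unique R (measure_function_pushforward__canonical__measure_function_Measure mu mf)) => // X.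
move=> /ocitvP[->|[[a b]/= ab ->]].
  by rewrite !measure0.
rewrite /pushforward (_ : _ @^-1` _ = `](a - d), (b - d)]%classic); last first.
  by apply/seteqP; split => x /=; rewrite !in_itv/= ltrBlDr lerBrDr.
rewrite !lebesgue_measure_itv/= !lte_fin ltrD2r ab -!EFinD; congr EFin; lra.
Qed.

Lemma Int_shift C h d : `|d| <= 1 -> dom C h -> Int (fun x => h (x + d)) = Int h.
Proof.
move=> d1 hC; have mf : measurable_fun (setT : set mR) ((+%R^~ d) : mR -> mR).
  exact: measurable_funD.
rewrite /Int /Rintegral; congr fine.
transitivity (\int[measure_function_pushforward__canonical__measure_function_Measure mu mf]_x (h x)%:E)%E.
  rewrite (@integral_pushforward _ _ mR mR R _ mf mu setT (EFin \o h))//.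
    by apply/measurable_EFinP; exact: hC.1.
  by rewrite preimage_setT; exact: (dom_integrable (dom_shift d1 hC)).
by apply: eq_measure_integral => A mA _; apply/esym; exact: (lebesgue_measure_shift d mA).
Qed.

Lemma Int_window C h (a b : nat -> R) : dom C h ->
  (forall x, \forall n \near \oo, a n <= x < b n) ->
  \int[mu]_(x in `[a n, b n[) h x @[n --> \oo] --> Int h.
Proof.
move=> hC ab.
rewrite (_ : (fun n => _) = fun n => Int (h \_ `[a n, b n[)); last first.
  by apply/funext => n; rewrite Rintegral_mkcond.
have [|x|//] := @Int_cvgT C (fun n => h \_ `[a n, b n[) h.
  move=> n; split.
    by apply/(measurable_restrictT _ _).1 => //; exact: measurable_funTS hC.1.
  move=> x; rewrite /patch; case: ifPn => _; first exact: hC.2.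
  by rewrite normr0 (le_trans _ (hC.2 x)).
apply: cvg_near_cst; near=> n; rewrite patchE ifT// inE/= in_itv/=.
by near: n; exact: ab.
Unshelve. all: by end_near. Qed.

Lemma weight_cvg0 (u : nat -> R) : (forall n, n%:R <= `|u n|) ->
  weight (u n) @[n --> \oo] --> 0.
Proof.
move=> nu; apply: (@squeeze_cvgr _ _ _ _ (fun=> 0) (@harmonic R)).
- apply: nearW => n; rewrite weight_ge0/= /weight /= /harmonic/= lef_pV2 ?posrE//.
    have := nu n; rewrite -(ler_pXn2r (_ : 0 < 2)%N)// ?nnegrE// real_normK ?num_real//.
    rewrite -natrX -natr1 => h; rewrite addrC lerD2l (le_trans _ h)// ler_nat; nia.
  by rewrite ltr_pwDl// sqr_ge0.
- exact: cvg_cst.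
- exact: cvg_harmonic.
Qed.

(** The fundamental theorem on growing windows leaves boundary values of [F], which tend to 0 by the
    decay of [F]. Integration by parts is applied in this form. *)
Lemma Int_derive C D (F f : R -> R) : (forall x, is_derive x 1 F (f x)) ->
  continuous f -> dom C f -> (forall x, `|F x| <= D * weight x) -> Int f = 0.
Proof.
move=> dF cf fC FD.
have cF : continuous F.
  by move=> x; apply: differentiable_continuous; apply/derivable1_diffP; case: (dF x).
have wc (e : R) : `|e| = 1 -> F (e * n.+1%:R) @[n --> \oo] --> 0.
  move=> e1; apply: norm_cvg0; apply: (@squeeze_cvgr _ _ _ _ (fun=> 0)
    (fun n => D * weight (e * n.+1%:R))).
  - by apply: nearW => n; rewrite normr_ge0 FD.
  - exact: cvg_cst.
  - rewrite -[X in _ --> X](mulr0 D); apply: cvgMr; apply: weight_cvg0 => n.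
    by rewrite normrM e1 mul1r ger0_norm// ler_nat.
have h : \int[mu]_(x in `[(-1) * n.+1%:R, 1 * n.+1%:R[) f x @[n --> \oo] --> Int f.
  apply: (Int_window fC) => x; near=> n; rewrite mul1r mulN1r.
  have : `|x| < n.+1%:R.
    near: n; exists (Num.truncn `|x|) => // n/= xn.
    by rewrite (lt_le_trans (truncnS_gt _))// ler_nat.
  by move=> /ltr_normlP[? ->]; rewrite andbT; lra.
rewrite -(cvg_lim _ h)//; apply/cvg_lim => //.
rewrite (_ : (fun n => _) = fun n => F (1 * n.+1%:R) - F ((-1) * n.+1%:R)).
  by rewrite -[X in _ --> X](subrr 0); apply: cvgB; apply: wc; rewrite ?normrN normr1.
apply/funext => n; rewrite /Rintegral integral_itv_bndo_bndc; last first.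
  by apply/measurable_EFinP; apply: measurable_funTS; exact: fC.1.
rewrite (@continuous_FTC2 _ f F)//.
- by rewrite mul1r mulN1r; have : 0 < n.+1%:R :> R by []; lra.
- exact: continuous_subspaceT.
- split.
  + by move=> x _; case: (dF x).
  + exact/cvg_at_right_filter/cF.
  + exact/cvg_at_left_filter/cF.
- by move=> x _; rewrite derive1E; case: (dF x).
Unshelve. all: by end_near. Qed.

Definition dom2 C (F : R * R -> R) :=
  measurable_fun (setT : set (mR * mR)) (F : mR * mR -> mR) /\
  forall x y, `|F (x, y)| <= C * (weight x * weight y).

Lemma dom2_swap C F : dom2 C F -> dom2 C (fun z => F (z.2, z.1)).
Proof.
move=> [mF FC]; split; last by move=> x y; rewrite /= [weight x * _]mulrC FC.
by apply: (measurableT_comp mF); exact: measurable_swap.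
Qed.

Lemma dom2_section C F y : dom2 C F -> dom (C * weight y) (fun x => F (x, y)).
Proof.
move=> [mF FC]; split; first exact: measurable_fun_pair1.
by move=> x; rewrite -mulrA [weight y * _]mulrC.
Qed.

Lemma dom2_integrable C F : dom2 C F -> (mu \x mu)%E.-integrable setT (EFin \o F).
Proof.
move=> F2; have mF := F2.1; apply/integrable21ltyP; first exact/measurable_EFinP.
have c0 : 0 <= C by have := (F2.2 0 0); rewrite /weight expr0n/= addr0 invr1 !mulr1; exact: le_trans.
have mw : measurable_fun (setT : set mR) ((fun y => C * Int weight * weight y) : mR -> mR).
  by apply: measurable_funM => //; have [] := dom_weight.
apply: (@le_lt_trans _ _ (\int[mu]_y (C * Int weight * weight y)%:E)%E); last first.
  have /integrableP[_] := integrableZl measurableT (C * Int weight) integrable_weight.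
  apply: le_lt_trans; apply: ge0_le_integral => //=.
  - by move=> y _; rewrite lee_fin !mulr_ge0// ?Int_weight_ge0 ?weight_ge0.
  - exact/measurable_EFinP.
  - by apply/measurable_EFinP; exact: measurableT_comp.
  - by move=> y _; rewrite lee_fin ler_norm.
apply: ge0_le_integral => //=.
- by move=> y _; exact: integral_ge0.
- apply: (@measurable_fun_fubini_tonelli_G _ _ mR mR R mu (fun z => `|(F z)%:E|)%E) => //.
  by apply: measurableT_comp => //; exact/measurable_EFinP.
- exact/measurable_EFinP.
- move=> y _; have Fy := dom2_section y F2.
  have := Int_le (dom_norm Fy); rewrite ger0_norm; last by apply: Rintegral_ge0.
  rewrite /Int {1}/Rintegral -lee_fin fineK; last first.
    exact: (integrable_fin_num measurableT (dom_integrable (dom_norm Fy))).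
  by move/le_trans; apply; rewrite lee_fin mulrAC.
Qed.

Definition Int1 (F : R * R -> R) : R -> R := fun y => Int (fun x => F (x, y)).

Lemma Int1_dom C F : dom2 C F -> dom (C * Int weight) (Int1 F).
Proof.
move=> F2; split; last first.
  move=> y; rewrite mulrAC; apply: Int_le; exact: dom2_section.
have /(@measurable_fubini_G _ _ mR mR R mu mu) m := dom2_integrable F2.
exact: (measurableT_comp (fine_measurable measurableT) m).
Qed.

Lemma Int1E C F : dom2 C F -> Int (Int1 F) = \int[(mu \x mu)%E]_z F z.
Proof.
move=> F2; rewrite /Int /Rintegral -(integral21_prod_meas1 (dom2_integrable F2)).
congr fine; apply: eq_integral => y _; rewrite /Int1 /Int /Rintegral fineK//.
exact: (integrable_fin_num measurableT (dom_integrable (dom2_section y F2))).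
Qed.

Lemma Int_swap C F : dom2 C F -> Int (Int1 F) = Int (Int1 (fun z => F (z.2, z.1))).
Proof.
move=> F2; rewrite (Int1E F2) {1}/Rintegral -(integral12_prod_meas1 (dom2_integrable F2)).
congr fine; apply: eq_integral => y _; rewrite /Int1 /Int /Rintegral fineK//=.
exact: (integrable_fin_num measurableT (dom_integrable (dom2_section y (dom2_swap F2)))).
Qed.

Lemma Int1_le C F : dom2 C F -> `|Int (Int1 F)| <= C * Int weight ^+ 2.
Proof. by move=> /Int1_dom/Int_le; rewrite expr2 mulrA. Qed.

End decay.

(** * The Dirichlet kernel *)

Section dirichlet.
Context {R : realType}.
Implicit Types (x u v : R).

Definition symsum (K : nat) (f : int -> R) : R :=
  \sum_(i < K.*2.+1) f (i%:Z - K%:Z).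

Lemma symsum0 f : symsum 0 f = f 0.
Proof. by rewrite /symsum big_ord_recl big_ord0 addr0. Qed.

Lemma symsumS K f : symsum K.+1 f = f (- K.+1%:Z) + symsum K f + f K.+1%:Z.
Proof.
rewrite /symsum doubleS big_ord_recr big_ord_recl/= sub0r.
congr (_ + _ + f _); last by rewrite /bump/=; lia.
by apply: eq_bigr => i _; congr f; rewrite /bump/= add1n; lia.
Qed.

Lemma eq_symsum K f g : f =1 g -> symsum K f = symsum K g.
Proof. by move=> fg; apply: eq_bigr => i _. Qed.

Lemma symsumZ K f c : symsum K (fun k => c * f k) = c * symsum K f.
Proof. by rewrite /symsum mulr_sumr. Qed.

Lemma symsumZr K f c : symsum K (fun k => f k * c) = symsum K f * c.
Proof. by rewrite /symsum mulr_suml. Qed.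

Lemma symsumD K f g : symsum K (fun k => f k + g k) = symsum K f + symsum K g.
Proof. by rewrite /symsum big_split. Qed.

Lemma symsum_exchange K L (f : int -> int -> R) :
  symsum K (fun k => symsum L (fun l => f k l)) = symsum L (fun l => symsum K (fun k => f k l)).
Proof. exact: exchange_big. Qed.

Lemma ler_symsum K f g : (forall k, f k <= g k) -> symsum K f <= symsum K g.
Proof. by move=> fg; apply: ler_sum => i _. Qed.

Lemma ler_norm_symsum K f : `|symsum K f| <= symsum K (fun k => `|f k|).
Proof. exact: ler_norm_sum. Qed.

Definition dirichlet K u : R := symsum K (fun k => cos (2 * pi * k%:~R * u)).

Lemma dirichletS K u :
  dirichlet K.+1 u = dirichlet K u + 2 * cos (2 * pi * K.+1%:R * u).
Proof.
rewrite /dirichlet symsumS/= mulrNz mulrN mulNr cosN -[K.+1%:~R]/(K.+1%:R).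
by ring.
Qed.

Lemma dirichlet0 u : dirichlet 0 u = 1.
Proof. by rewrite /dirichlet symsum0 mulr0 mul0r cos0. Qed.

(** The sine parts of the addition formula are odd in [k] and cancel in a symmetric sum, so a common
    phase factors out. *)
Lemma symsum_cos K u v :
  symsum K (fun k => cos (2 * pi * k%:~R * u + v)) = dirichlet K u * cos v.
Proof.
elim: K => [|K ih]; first by rewrite symsum0 mulr0 mul0r add0r dirichlet0 mul1r.
rewrite symsumS ih dirichletS mulrNz mulrN mulNr -[K.+1%:~R]/(K.+1%:R).
by rewrite !cosD cosN sinN; ring.
Qed.

Lemma natr_dbl1 K : K.*2.+1%:R = 2 * K%:R + 1 :> R.
Proof. by rewrite -natr1 -mul2n natrM. Qed.

(** The usual quotient formula for the kernel, by telescoping. The product form remains true at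
    integers [u], where both sides vanish. *)
Lemma dirichlet_sin K u :
  dirichlet K u * sin (pi * u) = sin (K.*2.+1%:R * (pi * u)).
Proof.
elim: K => [|K ih]; first by rewrite dirichlet0 !mul1r.
rewrite dirichletS mulrDl ih.
rewrite !natr_dbl1 -[K.+1%:R]natr1; move: (K%:R) (pi : R) => k p.
have -> : (2 * k + 1) * (p * u) = 2 * p * (k + 1) * u - p * u by ring.
have -> : (2 * (k + 1) + 1) * (p * u) = 2 * p * (k + 1) * u + p * u by ring.
by rewrite sinB sinD; move: (sin (p * u)) => t; ring.
Qed.

Lemma ler_dirichlet K u : `|dirichlet K u| <= K.*2.+1%:R.
Proof.
rewrite (le_trans (ler_norm_symsum _ _))//.
rewrite (le_trans (ler_symsum _ (g := fun=> 1) _))//; first by move=> k; exact: cos_max.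
by rewrite /symsum sumr_const card_ord.
Qed.

Lemma continuous_dirichlet K : continuous (dirichlet K).
Proof.
elim: K => [|K ih] u.
  rewrite (_ : dirichlet 0 = fun=> 1); first exact: cvg_cst.
  by apply/funext => x; rewrite dirichlet0.
rewrite (_ : dirichlet K.+1 = fun u => dirichlet K u + 2 * cos (2 * pi * K.+1%:R * u)).
  apply: cvgD; first exact: ih.
  apply: cvgMr; apply: continuous_comp; last exact: continuous_cos.
  by apply: cvgMr; exact: cvg_id.
by apply/funext => x; rewrite dirichletS.
Qed.

Lemma sin_int (k : int) : sin (pi * k%:~R) = 0 :> R.
Proof.
have nat_case (n : nat) : sin (pi * n%:R) = 0 :> R.
  by elim: n => [|n ih]; rewrite ?mulr0 ?sin0// -natr1 mulrDr mulr1 sinDpi ih oppr0.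
case: k => n; first exact: nat_case.
by rewrite NegzE mulrNz mulrN sinN nat_case oppr0.
Qed.

Lemma cos_int (k : int) : `|cos (pi * k%:~R)| = 1 :> R.
Proof. by apply: sin0cos1; exact: sin_int. Qed.

Lemma normr_sinD_int u (k : int) : `|sin (pi * (u - k%:~R))| = `|sin (pi * u)|.
Proof. by rewrite mulrBr sinB sin_int mulr0 subr0 normrM cos_int mulr1. Qed.

(** Jordan's inequality with constant 1 instead of 2. For [u >= 0], write
    [sin (pi * u) = 2 * sin t * cos t] with [t = pi * u / 2 <= pi / 4]. The mean value theorem gives
    [sin t = cos c * t], and both cosines are at least [cos (pi / 4)], so the product is at least
    [t >= u]. Halving the angle is what keeps the cosines away from 0. *)
Lemma jordan u : `|u| <= 2^-1 -> `|u| <= `|sin (pi * u)|.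
Proof.
wlog u0 : u / 0 <= u => [h|].
  have [/h//|/ltW u0 u1] := leP 0 u.
  by have := h (- u); rewrite mulrN sinN !normrN oppr_ge0 u0 => /(_ isT u1).
rewrite ger0_norm// => u1; apply: le_trans (ler_norm _).
have [<-|une0] := eqVneq 0 u; first by rewrite mulr0 sin0.
have ugt0 : 0 < u by rewrite lt_def eq_sym une0.
have pi0 := pi_gt0 R; have pi2 := pi_ge2 R.
pose t := pi * u / 2.
have t0 : 0 < t by rewrite /t divr_gt0// mulr_gt0.
have t4 : t <= pi / 4 by rewrite /t; nra.
have sd x : x \in `]0, t[ -> is_derive x 1 (@sin R) (cos x) by move=> _; exact: is_derive_sin.
have sc : {within `[0, t], continuous (@sin R)}.
  by apply: continuous_subspaceT; exact: continuous_sin.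
have [c /[!in_itv]/= /andP[c0 ct] ctE] := MVT t0 sd sc.
have c4 : cos (pi / 4) <= cos c.
  rewrite leNgt ltr_cos// -?leNgt ?in_itv/=; [lra|lra|lra].
have c8 : cos (pi / 4) <= cos t.
  rewrite leNgt ltr_cos// -?leNgt ?in_itv/=; [lra|lra|lra].
have c40 : 0 < cos (pi / 4) :> R by apply: cos_gt0_pihalf; lra.
have c42 : cos (pi / 4) ^+ 2 = 2^-1 :> R.
  have := cos_mulr2n (pi / 4 : R).
  rewrite (_ : (pi / 4) *+ 2 = pi / 2); last by rewrite mulr2n; lra.
  by rewrite cos_pihalf mulr2n => h; lra.
have -> : pi * u = t *+ 2 by rewrite mulr2n /t; lra.
rewrite sin_mulr2n mulr2n.
move: ctE; rewrite sin0 !subr0 => ->.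
have : cos (pi / 4) ^+ 2 * t <= cos t * (cos c * t).
  rewrite mulrA expr2; apply: ler_wpM2r; first exact: ltW.
  by apply: ler_pM => //; exact: ltW.
by rewrite c42 {1}/t; nra.
Qed.

End dirichlet.

Section affine.
Context {R : realType}.
Implicit Types (p q x : R).

Lemma is_derive_affine p q x : is_derive x 1 (fun y => p * y + q) p.
Proof.
have h := is_deriveD (is_deriveZ p (is_derive_id x 1)) (is_derive_cst q x 1).
by apply: (is_derive_eq h); rewrite addr0 -[_ *: _]/(p * 1) mulr1.
Qed.

Lemma is_derive_sin_affine p q x :
  is_derive x 1 (fun y => sin (p * y + q)) (p * cos (p * x + q)).
Proof.
have h := @is_derive1_comp R sin (fun y => p * y + q) x _ _ (is_derive_sin _) (is_derive_affine p q x).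
by apply: (is_derive_eq h); rewrite mulrC.
Qed.

Lemma is_derive_cos_affine p q x :
  is_derive x 1 (fun y => cos (p * y + q)) (- p * sin (p * x + q)).
Proof.
have h := @is_derive1_comp R cos (fun y => p * y + q) x _ _ (is_derive_cos _) (is_derive_affine p q x).
by apply: (is_derive_eq h); rewrite mulrC mulrN mulNr.
Qed.

End affine.

(** * Sampling on a one-dimensional lattice and localisation of the Dirichlet kernel *)

Section nodes.
Context {R : realType}.
Notation mR := (measurableTypeR R).
Notation mu := (@lebesgue_measure R).
Variables a s : R.
Hypothesis a1 : 1 <= a.
Implicit Types (x y C : R) (h : R -> R).

Let a0 : 0 < a. Proof. exact: lt_le_trans a1. Qed.
Let aneq0 : a != 0. Proof. by rewrite gt_eqF. Qed.

(** The coordinate in which the lattice [s + Z / a] becomes the integers. As [1 <= a], its spacing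
    is at most 1, so [weight_near] applies between a point and its node. *)
Definition lcoord x : R := a * (x - s).

(** Rounding to the nearest integer, ties going up: cells are closed on the left and open on the
    right. *)
Definition cell x : int := Num.floor (lcoord x + 2^-1).

Definition node x : R := s + (cell x)%:~R / a.

Lemma cell_itv x : (cell x)%:~R <= lcoord x + 2^-1 < (cell x)%:~R + 1.
Proof. by rewrite floor_le/= -intrD1 floorD1_gt. Qed.

Lemma cell_eq x (k : int) : k%:~R - 2^-1 <= lcoord x < k%:~R + 2^-1 -> cell x = k.
Proof. by move=> h; apply/floor_def; rewrite intrD; apply/andP; split; lra. Qed.

Lemma coord_node x : lcoord (node x) = (cell x)%:~R.
Proof. by rewrite /lcoord /node addrC addKr mulrC divfK. Qed.

Lemma coordB x y : lcoord x - lcoord y = a * (x - y).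
Proof. by rewrite /lcoord; ring. Qed.

Lemma cell_near x : `|lcoord x - (cell x)%:~R| <= 2^-1.
Proof. by have := cell_itv x; rewrite ler_norml => /andP[? ?]; apply/andP; split; lra. Qed.

Lemma node_near x : `|x - node x| <= 2^-1.
Proof.
apply: le_trans (cell_near x); rewrite -coord_node coordB normrM (gtr0_norm a0).
by rewrite ler_peMl.
Qed.

Lemma sin_coord x : a * `|x - node x| <= `|sin (pi * lcoord x)|.
Proof.
rewrite -(normr_sinD_int _ (cell x)); apply: le_trans (jordan (cell_near x)).
by rewrite -coord_node coordB normrM (gtr0_norm a0).
Qed.

Lemma measurable_node : measurable_fun (setT : set mR) (node : mR -> mR).
Proof.
apply: nondecreasing_measurable => // x y xy.
rewrite /node lerD2l ler_pM2r ?invr_gt0// ler_int; apply: le_floor.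
by rewrite lerD2r /lcoord ler_pM2l// lerB.
Qed.

(** The local Lipschitz constant itself decays like [weight]; this is what makes [quotient]
    dominated and not merely bounded. *)
Definition lipschitz_dom C h := dom C h /\
  forall x y, `|x - y| <= 1 -> `|h x - h y| <= C * `|x - y| * weight x.

Lemma dom_node C h : dom C h -> dom (3 * C) (h \o node).
Proof.
move=> hC; split.
  by apply: (measurableT_comp hC.1); exact: measurable_node.
move=> x; rewrite (le_trans (hC.2 _))// [3 * C]mulrC -mulrA ler_wpM2l//.
  exact: dom_ge0 hC.
by rewrite weight_near// (le_trans (node_near x))//; lra.
Qed.

(** Numerator and denominator vanish together at the lattice points. By [sin_coord] the denominator
    is at least the distance to the node, so a Lipschitz numerator keeps the quotient under
    control. *)
Definition quotient h x := (h x - h (node x)) / sin (pi * lcoord x).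

Lemma sin_coord0 x : sin (pi * lcoord x) = 0 -> x = node x.
Proof.
move=> h; have := sin_coord x; rewrite h normr0 pmulr_rle0// normr_le0.
by rewrite subr_eq0 => /eqP.
Qed.

Lemma quotient_dirichlet K h x :
  (h x - h (node x)) * dirichlet K (lcoord x) =
  quotient h x * sin (K.*2.+1%:R * (pi * lcoord x)).
Proof.
rewrite -dirichlet_sin /quotient.
have [/sin_coord0 <-|s0] := eqVneq (sin (pi * lcoord x)) 0.
  by rewrite subrr !mul0r.
by field.
Qed.

Lemma continuous_coord : continuous lcoord.
Proof.
by move=> x; apply: cvgMr; apply: cvgB; [exact: cvg_id|exact: cvg_cst].
Qed.

Lemma measurable_sin_coord u : measurable_fun (setT : set mR)
  ((fun x => sin (u * (pi * lcoord x))) : mR -> mR).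
Proof.
apply: continuous_measurable_fun => x.
apply: continuous_comp; last exact: continuous_sin.
by do 2 apply: cvgMr; exact: continuous_coord.
Qed.

(** The inverse of [z] is the limit of [z / (z ^+ 2 + n.+1%:R^-1)], also at [z = 0], where every
    term and the default inverse are 0. *)
Lemma measurable_sin_coordV : measurable_fun (setT : set mR)
  ((fun x => (sin (pi * lcoord x))^-1) : mR -> mR).
Proof.
pose u n x := sin (pi * lcoord x) / (sin (pi * lcoord x) ^+ 2 + n.+1%:R^-1).
have cs : continuous (fun x => sin (pi * lcoord x)).
  move=> x; apply: continuous_comp; last exact: continuous_sin.
  by apply: cvgMr; exact: continuous_coord.
have u0 n x : sin (pi * lcoord x) ^+ 2 + n.+1%:R^-1 != 0.
  by rewrite gt_eqF// ltr_wpDl ?sqr_ge0.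
apply: (@measurable_fun_cvg _ mR R setT u) => [n|x _].
  apply: continuous_measurable_fun => x; apply: cvgM; first exact: cs.
  apply: cvgV => //; apply: cvgD; last exact: cvg_cst.
  by apply: cvgM; exact: cs.
have [s0|s0] := eqVneq (sin (pi * lcoord x)) 0.
  by rewrite /u s0 invr0; under eq_fun do rewrite mul0r; exact: cvg_cst.
have -> : (sin (pi * lcoord x))^-1 = sin (pi * lcoord x) / (sin (pi * lcoord x) ^+ 2 + 0).
  by rewrite addr0; field.
apply: cvgM; first exact: cvg_cst.
apply: cvgV; first by rewrite addr0 sqrf_eq0.
by apply: cvgD; [exact: cvg_cst|exact: cvg_harmonic].
Qed.

Lemma dom_quotient C h : lipschitz_dom C h -> dom C (quotient h).
Proof.
move=> [hC hL]; split.
  apply: measurable_funM.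
    by apply: measurable_funB; [exact: hC.1|exact: (dom_node hC).1].
  exact: measurable_sin_coordV.
move=> x; rewrite /quotient normrM normfV.
have [/sin_coord0 <-|s0] := eqVneq (sin (pi * lcoord x)) 0.
  by rewrite subrr normr0 mul0r (le_trans _ (hC.2 x)).
rewrite ler_pdivrMr ?normr_gt0//.
have xn1 : `|x - node x| <= 1 by rewrite (le_trans (node_near x))//; lra.
rewrite (le_trans (hL _ _ xn1))// mulrAC ler_wpM2l//.
  by rewrite mulr_ge0 ?weight_ge0// (dom_ge0 hC).
by rewrite (le_trans _ (sin_coord x))// ler_peMl.
Qed.

(** Since cells are closed on the left, small translates to the right never leave a cell, not even
    from its end point. Hence only positive shifts are used in the Riemann-Lebesgue argument. *)
Lemma node_right x (d : nat -> R) : (forall n, 0 <= d n) -> d n @[n --> \oo] --> 0 ->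
  \forall n \near \oo, node (x + d n) = node x.
Proof.
move=> d0 dcvg; have /andP[c1 c2] := cell_itv x.
have e0 : 0 < ((cell x)%:~R + 2^-1 - lcoord x) / a by rewrite divr_gt0//; lra.
have /cvgrPdist_lt/(_ _ e0) := dcvg; apply: filterS => n.
rewrite sub0r normrN (ger0_norm (d0 n)) ltr_pdivlMr// => dn.
rewrite /node (@cell_eq (x + d n) (cell x))//.
have -> : lcoord (x + d n) = lcoord x + d n * a by rewrite /lcoord; ring.
have dan : 0 <= d n * a by rewrite mulr_ge0// ltW.
by apply/andP; split; lra.
Qed.

Lemma lipschitz_continuous C h : lipschitz_dom C h -> continuous h.
Proof.
move=> [hC hL] x; apply/cvgrPdist_le => e e0.
have C0 := dom_ge0 hC.
near=> y; have xy : `|x - y| <= 1.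
  by near: y; apply: (@cvgr_dist_le _ _ _ (nbhs x) _ id x); [exact: cvg_id|].
rewrite (le_trans (hL _ _ xy))//.
have w1 : weight x <= 1 by rewrite /weight invf_le1 ?ltr_pwDl ?lerDl ?sqr_ge0.
have xyC : `|x - y| <= e / (C + 1).
  near: y; apply: (@cvgr_dist_le _ _ _ (nbhs x) _ id x); first exact: cvg_id.
  by rewrite divr_gt0// ltr_wpDl.
move: xyC; rewrite ler_pdivlMr ?ltr_wpDl//.
have := normr_ge0 (x - y); have := weight_ge0 x; nra.
Unshelve. all: by end_near. Qed.

Lemma quotient_cvg C h x (d : nat -> R) : lipschitz_dom C h ->
  (forall n, 0 <= d n) -> d n @[n --> \oo] --> 0 -> x <> node x ->
  quotient h (x + d n) @[n --> \oo] --> quotient h x.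
Proof.
move=> hL d0 dcvg xn.
have xd : x + d n @[n --> \oo] --> x.
  by rewrite -[X in _ --> X]addr0; apply: cvgD => //; exact: cvg_cst.
apply: cvgM.
  apply: cvgB; first exact: (cvg_comp _ _ xd (lipschitz_continuous hL (x:=x))).
  apply: cvg_near_cst; near=> n; congr h; near: n; exact: node_right.
apply: cvgV; first by apply/eqP => /sin_coord0.
apply: (cvg_comp (fun n => x + d n) (fun y => sin (pi * lcoord y)) xd).
have csin : continuous (fun y => sin (pi * lcoord y)).
  move=> y; apply: continuous_comp; last exact: continuous_sin.
  by apply: cvgMr; exact: continuous_coord.
exact: csin.
Unshelve. all: by end_near. Qed.

Lemma countable_nodes : countable [set x | x = node x].
Proof.
apply: (@sub_countable _ _ _ ((fun k : int => s + k%:~R / a) @` setT)).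
  by apply: subset_card_le => x /= xn; exists (cell x).
exact: (card_le_trans (card_image_le _ _) (countableP _)).
Qed.

Definition halfperiod (n : nat) : R := (n.*2.+1%:R * a)^-1.

Lemma halfperiod_gt0 n : 0 < halfperiod n.
Proof. by rewrite invr_gt0 mulr_gt0. Qed.

Lemma halfperiod_le1 n : halfperiod n <= 1.
Proof. by rewrite invf_le1 ?mulr_gt0// mulr_ege1// ler1n. Qed.

Lemma halfperiod_cvg0 : halfperiod n @[n --> \oo] --> 0.
Proof.
apply: (@squeeze_cvgr _ _ _ _ (fun=> 0) (@harmonic R)); last 2 first.
- exact: cvg_cst.
- exact: cvg_harmonic.
apply: nearW => n; rewrite (ltW (halfperiod_gt0 n))/= /halfperiod /harmonic/=.
rewrite lef_pV2 ?posrE ?mulr_gt0// (@le_trans _ _ n.*2.+1%:R)//.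
  by rewrite ler_nat ltnS -addnn leq_addr.
by rewrite ler_peMr.
Qed.

Lemma sin_halfperiod n x :
  sin (n.*2.+1%:R * (pi * lcoord (x + halfperiod n))) =
  - sin (n.*2.+1%:R * (pi * lcoord x)).
Proof.
rewrite -sinDpi; congr sin; rewrite /lcoord /halfperiod.
have : n.*2.+1%:R != 0 :> R by rewrite pnatr_eq0.
by move: (n.*2.+1%:R) => k k0; field; rewrite aneq0 k0.
Qed.

(* Riemann-Lebesgue: translating by half a period of the sine changes its sign. *)
Lemma quotient_sin_cvg0 C h : lipschitz_dom C h ->
  Int (fun x => quotient h x * sin (n.*2.+1%:R * (pi * lcoord x)))
    @[n --> \oo] --> 0.
Proof.
move=> hL; have gC := dom_quotient hL; set g := quotient h in gC *.
pose ph n x := sin (n.*2.+1%:R * (pi * lcoord x)).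
have sn n x : `|ph n x| <= 1 by exact: sin_max.
have gphC n : dom (C * 1) (fun x => g x * ph n x).
  by apply: domM => //; exact: measurable_sin_coord.
have d1 n : `|halfperiod n| <= 1.
  by rewrite gtr0_norm ?halfperiod_gt0 ?halfperiod_le1.
have gsC n := dom_shift (d1 n) gC.
have gsphC n : dom (3 * C * 1) (fun x => g (x + halfperiod n) * ph n x).
  by apply: domM => //; exact: measurable_sin_coord.
have key n : 2 * Int (fun x => g x * ph n x) =
    Int (fun x => (g x - g (x + halfperiod n)) * ph n x).
  transitivity (Int (fun x => g x * ph n x - g (x + halfperiod n) * ph n x)); last first.
    by congr Int; apply/funext => x; rewrite mulrBl.
  rewrite (IntB (gphC n) (gsphC n)).
  suff -> : Int (fun x => g (x + halfperiod n) * ph n x) =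
    - Int (fun x => g x * ph n x) by lra.
  rewrite -(Int_shift (d1 n) (gphC n)) -mulN1r -(IntZ (-1) (dom_shift (d1 n) (gphC n))).
  by congr Int; apply/funext => x; rewrite /ph sin_halfperiod; ring.
have dC n : dom (C + 3 * C) (fun x => g x - g (x + halfperiod n)).
  exact: domB gC (gsC n).
have lim0 : Int (fun x => `|g x - g (x + halfperiod n)|) @[n --> \oo] --> 0.
  rewrite -[X in _ --> X](@Int0 R).
  apply: (@Int_cvg _ (C + 3 * C) _ _ [set x | x = node x]) => [n|//||x xn].
  - exact: dom_norm.
  - exact: countable_nodes.
  - rewrite -[X in _ --> X](normr0 R) -[in X in _ --> X](subrr (g x)).
    apply: cvg_norm; apply: cvgB; first exact: cvg_cst.
    apply: (quotient_cvg hL) => // [n|]; first exact/ltW/halfperiod_gt0.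
    exact: halfperiod_cvg0.
apply: norm_cvg0; apply: (@squeeze_cvgr _ _ _ _ (fun=> 0) _ _ _ _ (cvg_cst _) lim0).
apply: nearW => n; rewrite normr_ge0/=.
have dph : dom ((C + 3 * C) * 1) (fun x => (g x - g (x + halfperiod n)) * ph n x).
  by apply: domM => //; exact: measurable_sin_coord.
have : `|2 * Int (fun x => g x * ph n x)| <= Int (fun x => `|g x - g (x + halfperiod n)|).
  rewrite key (le_trans (normr_Int dph))//.
  apply: (le_Int (dom_norm dph) (dom_norm (dC n))) => x.
  by rewrite normrM ler_piMr.
rewrite normrM ger0_norm// => ?.
have := normr_ge0 (Int (fun x => g x * ph n x)); rewrite /ph in key *; lra.
Qed.


(** The left end of the cell of index [i - M]. The cells with [i < M.*2.+1] are those whose nodes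
    occur in [symsum M]. *)
Let edge (M i : nat) : R := s + (i%:R - M%:R - 2^-1) / a.

Let edgeE M i : lcoord (edge M i) = i%:R - M%:R - 2^-1.
Proof. by rewrite /lcoord /edge addrC addKr mulrC divfK. Qed.

Let edge_lt M i j : (i < j)%N -> edge M i < edge M j.
Proof.
by move=> ij; rewrite ltrD2l ltr_pM2r ?invr_gt0// !ltrD2r ltr_nat.
Qed.

Let coord_lt x y : (lcoord x < lcoord y) = (x < y).
Proof. by rewrite /lcoord ltr_pM2l// ltrD2r. Qed.

Let coord_le x y : (lcoord x <= lcoord y) = (x <= y).
Proof. by rewrite /lcoord ler_pM2l// lerD2r. Qed.

(** On each cell [h \o node] is constant, so only the increment of the primitive [Phi] remains. It
    is used with [phi = 1], for lattice sums, and with a cosine, for orthogonality. *)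
Lemma lattice_window C D h (phi Phi : R -> R) M n : dom C h ->
  continuous phi -> (forall x, `|phi x| <= D) ->
  (forall x, is_derive x 1 Phi (phi x)) ->
  \int[mu]_(x in `[edge M 0, edge M n[) (h (node x) * phi x) =
  \sum_(i < n) h (s + (i%:Z - M%:Z)%:~R / a) * (Phi (edge M i.+1) - Phi (edge M i)).
Proof.
move=> hC cphi phiD dPhi.
have hphi : dom (3 * C * D) (fun x => (h \o node) x * phi x).
  by apply: (domM (dom_node hC)) => //; exact: continuous_measurable_fun.
have cPhi : continuous Phi.
  by move=> x; apply: differentiable_continuous; apply/derivable1_diffP; case: (dPhi x).
elim: n => [|n ih]; first by rewrite big_ord0 set_itv_ge -?leNgt ?bnd_simp// Rintegral_set0.
have e0 : edge M 0 <= edge M n.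
  by case: n {ih} => // n; exact/ltW/edge_lt.
rewrite (@itv_bndbnd_setU _ _ _ (BLeft (edge M n))); last 2 first.
- by rewrite bnd_simp.
- by rewrite bnd_simp ltW// edge_lt.
rewrite Rintegral_setU//=; last 2 first.
- by apply: integrableS (dom_integrable hphi) => //; exact: measurableU.
- apply/disj_setPS => y [/=]; rewrite 2!in_itv/= => /andP[_ yx] /andP[].
  by rewrite leNgt yx.
rewrite ih big_ord_recr/=; congr (_ + _).
transitivity (\int[mu]_(x in `[edge M n, edge M n.+1[)
    (h (s + (n%:Z - M%:Z)%:~R / a) * phi x)).
  apply: eq_Rintegral.
  move=> x /[!inE]/=; rewrite in_itv/= => /andP[xl xr].
  rewrite /node (@cell_eq x (n%:Z - M%:Z))//.
  have : lcoord (edge M n) <= lcoord x by rewrite coord_le.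
  have : lcoord x < lcoord (edge M n.+1) by rewrite coord_lt.
  rewrite !edgeE intrB -natr1 -[n%:~R]/(n%:R) -[M%:~R]/(M%:R).
  move: (n%:R) (M%:R) (lcoord x) => n' M' c ? ?.
  by apply/andP; split; lra.
have iphi : mu.-integrable `[edge M n, edge M n.+1] (EFin \o phi).
  by apply: continuous_compact_integrable; [exact: segment_compact|exact: continuous_subspaceT].
rewrite RintegralZl//; last first.
  by apply: integrableS iphi => //; exact: subset_itv_co_cc.
congr (_ * _); rewrite /Rintegral integral_itv_bndo_bndc; last first.
  by apply/measurable_EFinP; apply: measurable_funTS; exact: continuous_measurable_fun.
rewrite (@continuous_FTC2 _ phi Phi)//.
- exact: edge_lt.
- exact: continuous_subspaceT.
- split.
  + by move=> x _; case: (dPhi x).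
  + exact/cvg_at_right_filter/cPhi.
  + exact/cvg_at_left_filter/cPhi.
- by move=> x _; rewrite derive1E; case: (dPhi x).
Qed.

Lemma window_cvg x : \forall M \near \oo, edge M 0 <= x < edge M M.*2.+1.
Proof.
exists (Num.truncn `|lcoord x|).+1 => // M/= xM.
have : `|lcoord x| < M%:R.
  by rewrite (lt_le_trans (truncnS_gt _))// ler_nat.
rewrite -coord_le -coord_lt !edgeE natr_dbl1 => /ltr_normlP[? ?].
by apply/andP; split; lra.
Qed.

(** Each cell has length [1 / a], so a partial lattice sum is the integral of the step function over
    a window. Lattice sums thereby inherit the convergence theorems for integrals. *)
Lemma symsum_node_cvg C h : dom C h ->
  symsum M (fun k => h (s + k%:~R / a)) / a @[M --> \oo] --> Int (h \o node).
Proof.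
move=> hC; have := Int_window (dom_node hC) window_cvg; apply: cvg_trans.
apply: near_eq_cvg; near=> M.
rewrite /symsum mulr_suml.
have := @lattice_window C 1 h (fun=> 1) id M M.*2.+1 hC (fun=> cvg_cst _).
under eq_Rintegral do rewrite mulr1.
move=> ->; first last.
- by rewrite normr1.
by apply: eq_bigr => i _; congr (_ * _); rewrite /edge -natr1; field.
Unshelve. all: by end_near. Qed.

(** A cell contains [k] whole periods up to sign. Concretely, the cell ends have half-integer
    coordinates, where the sine in the primitive [Phi] vanishes. *)
Lemma Int_node_cos C h (k : int) : k != 0 -> dom C h ->
  Int (fun x => h (node x) * cos (2 * pi * k%:~R * lcoord x)) = 0.
Proof.
move=> k0 hC.
have ccos : continuous (fun x => cos (2 * pi * k%:~R * lcoord x)).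
  move=> x; apply: continuous_comp; last exact: continuous_cos.
  by apply: cvgMr; exact: continuous_coord.
have c1 x : `|cos (2 * pi * k%:~R * lcoord x)| <= 1 by exact: cos_max.
have hc : dom (3 * C * 1) (fun x => h (node x) * cos (2 * pi * k%:~R * lcoord x)).
  by apply: (domM (dom_node hC)) => //; exact: continuous_measurable_fun.
have pk0 : 2 * pi * k%:~R * a != 0.
  by rewrite !mulf_neq0 ?intr_eq0// gt_eqF ?pi_gt0.
rewrite -(cvg_lim _ (Int_window hc window_cvg))//; apply/cvg_lim => //.
apply: cvg_near_cst; near=> M.
pose p := 2 * pi * k%:~R * a.
pose Phi x := p^-1 * sin (p * x + - (p * s)).
have coordE x : 2 * pi * k%:~R * lcoord x = p * x + - (p * s).
  by rewrite /lcoord /p; ring.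
have dPhi x : is_derive x 1 Phi (cos (2 * pi * k%:~R * lcoord x)).
  have := is_deriveZ p^-1 (is_derive_sin_affine p (- (p * s)) x).
  by move=> h'; apply: (is_derive_eq h'); rewrite coordE scalerA mulVf// scale1r.
rewrite (lattice_window _ _ hC ccos c1 dPhi); apply: big1 => i _.
have z (j : nat) : Phi (edge M j) = 0.
  rewrite /Phi -coordE edgeE (_ : _ * _ = pi * (k * (2 * (j%:Z - M%:Z) - 1))%:~R) ?sin_int ?mulr0//.
  by rewrite !(intrM, intrB) -[2%:~R]/(2%:R); field.
by rewrite !z subrr mulr0.
Unshelve. all: by end_near. Qed.

(** Of the kernel, only the constant term survives against a step function; this holds exactly for
    every [K]. *)
Lemma Int_node_dirichlet C h K : dom C h ->
  Int (fun x => h (node x) * dirichlet K (lcoord x)) = Int (h \o node).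
Proof.
move=> hC.
have cD K' : continuous (fun x => dirichlet K' (lcoord x)).
  move=> x; apply: continuous_comp; last exact: continuous_dirichlet.
  exact: continuous_coord.
have dD K' : dom (3 * C * K'.*2.+1%:R) (fun x => h (node x) * dirichlet K' (lcoord x)).
  apply: (domM (dom_node hC)); first exact: continuous_measurable_fun.
  by move=> x; exact: ler_dirichlet.
have ccos k : continuous (fun x => cos (2 * pi * k%:R * lcoord x)).
  move=> x; apply: continuous_comp; last exact: continuous_cos.
  by apply: cvgMr; exact: continuous_coord.
have dc (k : nat) : dom (3 * C * 1) (fun x => h (node x) * cos (2 * pi * k%:R * lcoord x)).
  apply: (domM (dom_node hC)); first exact: continuous_measurable_fun.
  by move=> x; exact: cos_max.
elim: K => [|K ih].
  by congr Int; apply/funext => x; rewrite dirichlet0 mulr1.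
transitivity (Int (fun x => h (node x) * dirichlet K (lcoord x) +
    (h (node x) * cos (2 * pi * K.+1%:R * lcoord x)) * 2)).
  by congr Int; apply/funext => x; rewrite dirichletS; ring.
have dc2 : dom (3 * C * 1 * 2) (fun x => h (node x) * cos (2 * pi * K.+1%:R * lcoord x) * 2).
  by apply: (domM (dc _)) => // x; rewrite ger0_norm.
by rewrite (IntD (dD K) dc2) ih (IntZr _ (dc _)) (@Int_node_cos C h K.+1)// mul0r addr0.
Qed.

(** Splits [h] into its step function and a remainder vanishing at the nodes. For the remainder,
    [dirichlet_sin] trades the kernel for a single sine, which serves both the limit and a bound
    uniform in [K]. *)
Lemma Int_dirichletE C h K : lipschitz_dom C h ->
  Int (fun x => h x * dirichlet K (lcoord x)) =
  Int (h \o node) + Int (fun x => quotient h x * sin (K.*2.+1%:R * (pi * lcoord x))).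
Proof.
move=> hL; have hC := hL.1.
rewrite -(Int_node_dirichlet K hC).
rewrite -(@IntD _ (3 * C * K.*2.+1%:R) (C * 1)).
- congr Int; apply/funext => x; rewrite -quotient_dirichlet; ring.
- apply: (domM (dom_node hC)) => [|x]; last exact: ler_dirichlet.
  apply: continuous_measurable_fun => x.
  apply: continuous_comp; last exact: continuous_dirichlet.
  exact: continuous_coord.
- apply: (domM (dom_quotient hL)) => [|x]; last exact: sin_max.
  exact: measurable_sin_coord.
Qed.

Lemma Int_dirichlet_cvg C h : lipschitz_dom C h ->
  Int (fun x => h x * dirichlet K (lcoord x)) @[K --> \oo] --> Int (h \o node).
Proof.
move=> hL; rewrite (funext (fun K => Int_dirichletE K hL)).
rewrite -[X in _ --> X]addr0; apply: cvgD; first exact: cvg_cst.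
exact: quotient_sin_cvg0 hL.
Qed.

(** The kernel has supremum of order [K], yet the bound is uniform: 3 from the step function and 1
    from the quotient. Dominated convergence in the other variable relies on it. *)
Lemma Int_dirichlet_le C h K : lipschitz_dom C h ->
  `|Int (fun x => h x * dirichlet K (lcoord x))| <= 4 * C * Int weight.
Proof.
move=> hL; rewrite (Int_dirichletE _ hL) (le_trans (ler_normD _ _))//.
have := Int_le (dom_node hL.1).
have /Int_le : dom (C * 1) (fun x => quotient h x * sin (K.*2.+1%:R * (pi * lcoord x))).
  apply: (domM (dom_quotient hL)) => [|x]; last exact: sin_max.
  exact: measurable_sin_coord.
lra.
Qed.

End nodes.

(** * Poisson summation in the plane *)

Section double_sums.
Context {R : realType}.
Implicit Types (p q : int -> R) (j : int -> int -> R).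

Lemma eq_cvgn (u v : nat -> R) (l : R) : u =1 v ->
  u n @[n --> \oo] --> l -> v n @[n --> \oo] --> l.
Proof. by move=> /funext ->. Qed.

Lemma cvg_symsum K (u : nat -> int -> R) (l : int -> R) :
  (forall k, u n k @[n --> \oo] --> l k) ->
  symsum K (u n) @[n --> \oo] --> symsum K l.
Proof.
move=> ul; elim: K => [|K ih].
  by rewrite symsum0; apply: eq_cvgn (ul 0) => n; rewrite symsum0.
rewrite symsumS; apply: eq_cvgn (cvgD (cvgD (ul _) ih) (ul _)) => n.
by rewrite symsumS.
Qed.

Lemma symsum_cvg_le p Q N : (forall k, 0 <= p k) ->
  symsum n p @[n --> \oo] --> Q -> symsum N p <= Q.
Proof.
move=> p0 pQ; rewrite -(cvg_lim _ pQ)//.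
apply: nondecreasing_cvgn_le; last by apply/cvg_ex; exists Q.
by apply/nondecreasing_seqP => n; rewrite symsumS -addrA addrCA lerDl addr_ge0.
Qed.

(** One more step of the inner range adds the two rows with [l] equal to plus or minus [(L + d).+1],
    each at most [B * q l]. The bound does not involve [K], so it can be used on the diagonal
    [K = L]. *)
Lemma symsum_tail j p q B K L d : (forall k l, `|j k l| <= p k * q l) ->
  (forall l, 0 <= q l) -> (forall N, symsum N p <= B) ->
  `|symsum K (fun k => symsum (L + d) (j k)) - symsum K (fun k => symsum L (j k))|
    <= B * (symsum (L + d) q - symsum L q).
Proof.
move=> jpq q0 pB; elim: d => [|d ih]; first by rewrite addn0 !subrr normr0 mulr0.
have row l : `|symsum K (fun k => j k l)| <= B * q l.
  rewrite (le_trans (ler_norm_symsum _ _))//.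
  rewrite (le_trans (ler_symsum _ (fun k => jpq k l)))// symsumZr.
  by rewrite ler_wpM2r.
rewrite addnS.
have -> : symsum K (fun k => symsum (L + d).+1 (j k)) =
    symsum K (fun k => j k (- (L + d).+1%:Z)) +
    symsum K (fun k => symsum (L + d) (j k)) + symsum K (fun k => j k (L + d).+1%:Z).
  by rewrite -!symsumD; apply: eq_symsum => k; rewrite symsumS.
rewrite symsumS.
move: (row (- (L + d).+1%:Z)) (row (L + d).+1%:Z) ih.
move: (symsum K _) (symsum K _) (symsum K _) (symsum K _) => A D E F hA hE hD.
rewrite (_ : F + D + E - A = F + E + (D - A)); last by ring.
by rewrite (le_trans (ler_normD _ _))// (le_trans (lerD (ler_normD _ _) (lexx _)))//; lra.
Qed.

(* Absolute summability turns the iterated limit over rectangles into the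
   limit over squares. *)
Lemma symsum_square_cvg j p q (B Q : R) (r : nat -> R) (r' : R) :
  (forall k l, `|j k l| <= p k * q l) ->
  (forall l, 0 <= q l) -> (forall N, symsum N p <= B) ->
  symsum N q @[N --> \oo] --> Q ->
  (forall K, symsum K (fun k => symsum L (j k)) @[L --> \oo] --> r K) ->
  r K @[K --> \oo] --> r' ->
  symsum N (fun k => symsum N (j k)) @[N --> \oo] --> r'.
Proof.
move=> jpq q0 pB qQ jr rr'.
(* Letting [d] tend to infinity in [symsum_tail] bounds the distance to the row limit [r K],
   uniformly in [K]. *)
have bound K L : `|r K - symsum K (fun k => symsum L (j k))| <= B * (Q - symsum L q).
  have h1 : `|symsum K (fun k => symsum (d + L) (j k)) - symsum K (fun k => symsum L (j k))|
      @[d --> \oo] --> `|r K - symsum K (fun k => symsum L (j k))|.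
    apply: cvg_norm; apply: cvgB; last exact: cvg_cst.
    by have := jr K; rewrite -(cvg_shiftn L).
  have h2 : B * (symsum (d + L) q - symsum L q) @[d --> \oo] --> B * (Q - symsum L q).
    apply: cvgMr; apply: cvgB; last exact: cvg_cst.
    by have := qQ; rewrite -(cvg_shiftn L).
  rewrite -(cvg_lim _ h1)// -(cvg_lim _ h2)//.
  apply: ler_lim; [by apply/cvg_ex; eexists; exact: h1|by apply/cvg_ex; eexists; exact: h2|].
  by apply: nearW => d; rewrite addnC; exact: symsum_tail.
have dif : (symsum N (fun k => symsum N (j k)) - r N) @[N --> \oo] --> (0 : R).
  apply: norm_cvg0; apply: (@squeeze_cvgr _ _ _ _ (fun=> 0) (fun N => B * (Q - symsum N q))).
  - by apply: nearW => N; rewrite normr_ge0/= distrC.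
  - exact: cvg_cst.
  - rewrite -[X in _ --> X](mulr0 B) -[X in _ * X](subrr Q).
    by apply: cvgMr; apply: cvgB => //; exact: cvg_cst.
rewrite -[r']add0r; apply: eq_cvgn (cvgD dif rr') => N.
by rewrite subrK.
Qed.

End double_sums.

(** * Iterated Dirichlet integrals and lattice sums in two variables *)

Section poisson2.
Context {R : realType}.
Notation mR := (measurableTypeR R).
Implicit Types (C x y : R) (F : R * R -> R).

Lemma dom_sum C n (f : 'I_n -> R -> R) : (forall i, dom C (f i)) ->
  dom (n%:R * C) (fun x => \sum_i f i x) /\
  Int (fun x => \sum_i f i x) = \sum_i Int (f i).
Proof.
elim: n f => [|n ih] f fC.
  rewrite mul0r big_ord0; under eq_fun do rewrite big_ord0; split; last exact: Int0.
  by split => // x; rewrite normr0 mul0r.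
rewrite big_ord_recr/=; under eq_fun do rewrite big_ord_recr/=.
have [d i] := ih _ (fun i => fC (widen_ord (leqnSn n) i)).
split; last by rewrite (IntD d (fC ord_max)) i.
by have := domD d (fC ord_max); rewrite -natr1 mulrDl mul1r.
Qed.

Lemma Int_symsum C K (f : int -> R -> R) : (forall k, dom C (f k)) ->
  Int (fun x => symsum K (fun k => f k x)) = symsum K (fun k => Int (f k)).
Proof. by move=> fC; apply: (dom_sum (C := C) _).2. Qed.

Lemma dom2_ge0 C F : dom2 C F -> 0 <= C.
Proof. by move=> /(dom2_section 0)/dom_ge0; rewrite pmulr_lge0// weight_gt0. Qed.

Lemma Int1_symsum C K (f : int -> R * R -> R) : (forall k, dom2 C (f k)) ->
  Int (Int1 (fun z => symsum K (fun k => f k z))) = symsum K (fun k => Int (Int1 (f k))).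
Proof.
move=> fC; rewrite -(Int_symsum _ (fun k => Int1_dom (fC k))).
congr Int; apply/funext => y; rewrite /Int1 (@Int_symsum (C * weight y))// => k.
exact: dom2_section.
Qed.

Lemma dom2M C D F (G : R * R -> R) : dom2 C F ->
  measurable_fun (setT : set (mR * mR)) (G : mR * mR -> mR) ->
  (forall z, `|G z| <= D) -> dom2 (C * D) (fun z => F z * G z).
Proof.
move=> [mF FC] mG GD; split; first exact: measurable_funM.
by move=> x y; rewrite normrM mulrAC ler_pM.
Qed.

Lemma measurable_proj1 (g : R -> R) : measurable_fun (setT : set mR) (g : mR -> mR) ->
  measurable_fun (setT : set (mR * mR)) ((fun z => g z.1) : mR * mR -> mR).
Proof. by move=> mg; apply: (measurableT_comp mg); exact: measurable_fst. Qed.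

Definition lipschitz_dom2 C F := [/\ dom2 C F,
  forall x x' y, `|x - x'| <= 1 ->
    `|F (x, y) - F (x', y)| <= C * `|x - x'| * (weight x * weight y) &
  forall x y y', `|y - y'| <= 1 ->
    `|F (x, y) - F (x, y')| <= C * `|y - y'| * (weight x * weight y)].

Lemma lipschitz_dom2_section C F y : lipschitz_dom2 C F ->
  lipschitz_dom (C * weight y) (fun x => F (x, y)).
Proof.
move=> [F2 Fx _]; split; first exact: dom2_section.
by move=> x x' xx'; rewrite (le_trans (Fx _ _ _ xx'))// le_eqVlt; apply/orP; left; apply/eqP; ring.
Qed.

Variables a s b t : R.
Hypotheses (a1 : 1 <= a) (b1 : 1 <= b).

Definition partial_dirichlet F K y : R :=
  Int (fun x => F (x, y) * dirichlet K (lcoord a s x)).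

Lemma measurable_dirichlet_coord K : measurable_fun (setT : set mR)
  ((fun x => dirichlet K (lcoord a s x)) : mR -> mR).
Proof.
apply: continuous_measurable_fun => x.
apply: continuous_comp; last exact: continuous_dirichlet.
exact: continuous_coord.
Qed.

(** The constant grows with [K], which does no harm: this serves the limit in [L] at fixed [K],
    whereas the limit in [K] rests on the uniform bound [Int_dirichlet_le]. *)
Lemma partial_dirichlet_lipschitz C F K : lipschitz_dom2 C F ->
  lipschitz_dom (C * K.*2.+1%:R * Int weight) (partial_dirichlet F K).
Proof.
move=> FL; have [F2 Fx Fy] := FL.
have FD : dom2 (C * K.*2.+1%:R) (fun z => F z * dirichlet K (lcoord a s z.1)).
  apply: dom2M F2 _ _ => [|z]; last exact: ler_dirichlet.
  exact: (measurable_proj1 (measurable_dirichlet_coord K)).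
split; first exact: (Int1_dom FD).
move=> y y' yy'; rewrite /partial_dirichlet.
rewrite -(IntB (dom2_section y FD) (dom2_section y' FD)).
rewrite [leRHS](_ : _ = C * `|y - y'| * weight y * K.*2.+1%:R * Int weight); last by ring.
apply: Int_le.
rewrite (_ : (fun x => _) = fun x => (F (x, y) - F (x, y')) * dirichlet K (lcoord a s x)); last first.
  by apply/funext => x /=; rewrite mulrBl.
apply: domM => [||x]; [|exact: measurable_dirichlet_coord|exact: ler_dirichlet].
split; first exact: (domB (dom2_section y F2) (dom2_section y' F2)).1.
by move=> x; rewrite (le_trans (Fy _ _ _ yy'))// le_eqVlt; apply/orP; left; apply/eqP; ring.
Qed.

(** The sum of [F] over the plane lattice divided by the density [a * b], written as the integral of
    a step function so that Dirichlet integrals converge to it directly. *)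
Definition lattice_integral F : R :=
  Int (fun y => Int (fun x => F (node a s x, node b t y))).

Lemma partial_dirichlet_cvg C F K : lipschitz_dom2 C F ->
  Int (fun y => partial_dirichlet F K y * dirichlet L (lcoord b t y)) @[L --> \oo] -->
  Int (partial_dirichlet F K \o node b t).
Proof. move=> FL; have h := @Int_dirichlet_cvg _ b t b1 _ _ (partial_dirichlet_lipschitz K FL).
exact: h. Qed.

Lemma dirichlet_node_cvg C F : lipschitz_dom2 C F ->
  Int (partial_dirichlet F K \o node b t) @[K --> \oo] --> lattice_integral F.
Proof.
move=> FL; have C0 : 0 <= C by case: FL => /dom2_ge0.
(* The constant 12 is 4 from [Int_dirichlet_le] times 3 from moving [y] to its node. *)
have [|y|//] := @Int_cvgT _ (12 * C * Int weight)
  (fun K => partial_dirichlet F K \o node b t)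
  (fun y => Int (fun x => F (node a s x, node b t y))).
  move=> K; split; first by have [] := dom_node t b1 (partial_dirichlet_lipschitz K FL).1.
  move=> y /=; have := Int_dirichlet_le s a1 K (lipschitz_dom2_section (node b t y) FL).
  move/le_trans; apply.
  have : weight (node b t y) <= 3 * weight y.
    by apply: weight_near; rewrite (le_trans (node_near t b1 y))//; lra.
  have := @Int_weight_ge0 R; have := weight_ge0 (node b t y).
  move: (weight _) (weight _) (Int _) => v u w u0 w0 uv.
  have h : C * w * u <= C * w * (3 * v) by apply: ler_wpM2l => //; exact: mulr_ge0.
  by rewrite (_ : 4 * (C * u) * w = 4 * (C * w * u)); [|ring];
    rewrite (_ : 12 * C * w * v = 4 * (C * w * (3 * v))); [|ring]; rewrite ler_wpM2l.
have h := @Int_dirichlet_cvg _ a s a1 _ _ (lipschitz_dom2_section (node b t y) FL).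
exact: h.
Qed.

Let symsum_weight (c u : R) : 1 <= c ->
  symsum N (fun k => weight (u + k%:~R / c)) @[N --> \oo] --> Int (weight \o node c u) * c.
Proof.
move=> c1; apply: eq_cvgn (cvgM (symsum_node_cvg c1 dom_weight) (cvg_cst c)) => N.
by rewrite divfK// gt_eqF// (lt_le_trans _ c1).
Qed.

Lemma lattice_integralE C F : dom2 C F ->
  symsum N (fun l => symsum N (fun k => F (s + k%:~R / a, t + l%:~R / b))) / (a * b)
    @[N --> \oo] --> lattice_integral F.
Proof.
move=> F2; have C0 := dom2_ge0 F2.
have a0 : 0 < a by apply: lt_le_trans a1.
have b0 : 0 < b by apply: lt_le_trans b1.
have nF : dom2 (3 * C) (fun z => F (node a s z.1, z.2)).
  split; last first.
    move=> x y; rewrite (le_trans (F2.2 _ _))//=.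
    rewrite (_ : 3 * C * _ = C * ((3 * weight x) * weight y)); last by ring.
    rewrite ler_wpM2l// ler_wpM2r ?weight_ge0// weight_near//.
    by rewrite (le_trans (node_near s a1 x))//; lra.
  apply: (@measurableT_comp _ _ _ _ _ _ (F : mR * mR -> mR)); first exact: F2.1.
  apply: measurable_fun_pair; last exact: measurable_snd.
  by apply: measurable_proj1; exact: measurable_node.
(* Sum first over the first coordinate at a fixed height, then over the heights; the product of
   weights makes the double sum absolutely convergent, so that squares have the same limit. *)
have key : symsum N (fun l => symsum N (fun k => F (s + k%:~R / a, t + l%:~R / b)))
    @[N --> \oo] --> lattice_integral F * b * a.
  apply: (@symsum_square_cvg _ _ (fun l => C * weight (t + l%:~R / b))
    (fun k => weight (s + k%:~R / a)) (C * (Int (weight \o node b t) * b)) _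
    (fun L => symsum L (fun l => Int1 (fun z => F (node a s z.1, z.2)) (t + l%:~R / b)) * a)).
  - by move=> l k; rewrite (le_trans (F2.2 _ _))// -mulrA [weight (t + _) * _]mulrC.
  - by move=> k; exact: weight_ge0.
  - move=> N; rewrite symsumZ; apply: ler_wpM2l => //.
    have p0 (k : int) : 0 <= weight (t + k%:~R / b) by exact: weight_ge0.
    exact: (symsum_cvg_le N p0 (@symsum_weight b t b1)).
  - exact: symsum_weight.
  - move=> L; rewrite -symsumZr; apply: cvg_symsum => k.
    apply: eq_cvgn (cvgM (symsum_node_cvg a1
      (dom2_section (t + k%:~R / b) F2)) (cvg_cst a)) => N.
    by rewrite divfK// gt_eqF.
  - apply: cvgM; last exact: cvg_cst.
    apply: eq_cvgn (cvgM (symsum_node_cvg b1 (Int1_dom nF)) (cvg_cst b)) => N.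
    by rewrite divfK// gt_eqF.
rewrite (_ : lattice_integral F = lattice_integral F * b * a * (a * b)^-1).
  exact: (cvgM key (cvg_cst _)).
by field; rewrite !gt_eqF.
Qed.

End poisson2.

(** * Schwartz functions *)

Section plane_borel.
Context {R : realType}.
Notation mR := (measurableTypeR R).

(** An open set is a countable union of rational squares. This links the product topology, for which
    Schwartz functions are continuous, to the product sigma-algebra of [plane]. *)
Lemma open_plane_measurable (U : set (R * R)) : open U ->
  measurable (U : set (mR * mR)).
Proof.
move=> oU.
pose B (q : rat * rat * rat) : set (mR * mR) :=
  [set` `]ratr q.1.1 - ratr q.2, ratr q.1.1 + ratr q.2 : R[] `*`
  [set` `]ratr q.1.2 - ratr q.2, ratr q.1.2 + ratr q.2 : R[].
have -> : U = \bigcup_(q in [set q | B q `<=` U]) B q.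
  apply/seteqP; split; last by move=> z [q /= qU]; exact: qU.
  move=> [x y] Uz; have /nbhs_ballP[e /= e0 eU] : nbhs (x, y) U by exact: open_nbhs_nbhs.
  have /rat_in_itvoo[r /[!in_itv]/= /andP[r0 re]] : 0 < e / 2 by rewrite divr_gt0.
  have /rat_in_itvoo[p /[!in_itv]/= /andP[p1 p2]] : x - ratr r < x + ratr r by lra.
  have /rat_in_itvoo[q /[!in_itv]/= /andP[q1 q2]] : y - ratr r < y + ratr r by lra.
  exists (p, q, r); last by rewrite /B; split; rewrite /= in_itv/=; apply/andP; split; lra.
  move=> [u v] [] /=; rewrite !in_itv/= => /andP[? ?] /andP[? ?]; apply: eU.
  by split; rewrite /ball/= /ball_/= ltr_norml; apply/andP; split; lra.
rewrite bigcup_mkcond; apply: countable_bigcupT_measurable => [|q].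
  exact: countableP.
case: ifPn => _; last exact: measurable0.
apply: measurableX; exact: measurable_itv.
Qed.

Lemma continuous_plane_measurable (f : R * R -> R) : continuous f ->
  measurable_fun (setT : set (mR * mR)) (f : mR * mR -> mR).
Proof.
move=> cf; apply: (measurability _ (RGenOpens.measurableE R)) => _ [_ [a [b ->] <-]].
rewrite setTI; apply: open_plane_measurable; apply: open_comp => [z _|]; first exact: cf.
exact: interval_open.
Qed.

End plane_borel.

(** * Oscillatory integrals of Schwartz functions *)

Section oscillatory.
Context {R : realType}.
Notation mR := (measurableTypeR R).
Implicit Types (x y : R) (f g : R * R -> R).

Lemma mvt_le_lt (h h' : R -> R) (C x y : R) : 0 <= C -> x < y -> y - x <= 1 ->
  (forall u : R, is_derive u 1 h (h' u)) -> (forall u, `|h' u| <= C * weight u) ->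
  `|h x - h y| <= 3 * C * `|x - y| * weight x /\
  `|h x - h y| <= 3 * C * `|x - y| * weight y.
Proof.
move=> C0 xy xy1 dh hC.
have ch : {within `[x, y], continuous h}.
  apply: continuous_subspaceT => u; apply: differentiable_continuous.
  by apply/derivable1_diffP; case: (dh u).
have [c /[!in_itv]/= /andP[xc cy] hE] := MVT xy (fun u _ => dh u) ch.
rewrite distrC hE normrM [`|y - x|]distrC.
have k z : `|z - c| <= 1 -> `|h' c| * `|x - y| <= 3 * C * `|x - y| * weight z.
  move=> /weight_near wc; rewrite mulrAC ler_wpM2r// (le_trans (hC c))//.
  by rewrite [3 * C]mulrC -mulrA; exact: ler_wpM2l.
split; apply: k; rewrite ler_norml; apply/andP; split; lra.
Qed.

Lemma mvt_le (h h' : R -> R) (C x y : R) : 0 <= C -> `|x - y| <= 1 ->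
  (forall u : R, is_derive u 1 h (h' u)) -> (forall u, `|h' u| <= C * weight u) ->
  `|h x - h y| <= 3 * C * `|x - y| * weight x.
Proof.
move=> C0 xy1 dh hC; have [xy|xy|->] := ltgtP x y.
- have xy1' : y - x <= 1 by move: xy1; rewrite ler_norml => /andP[]; lra.
  exact: (mvt_le_lt C0 xy xy1' dh hC).1.
- have xy1' : x - y <= 1 by move: xy1; rewrite ler_norml => /andP[]; lra.
  by rewrite distrC [`|x - y|]distrC; exact: (mvt_le_lt C0 xy xy1' dh hC).2.
- by rewrite !subrr normr0 mulr0 mul0r.
Qed.

Lemma ler_dist_cos (p q x y : R) :
  `|cos (p * x + q) - cos (p * y + q)| <= `|p| * `|x - y|.
Proof.
wlog xy : x y / x < y => [h|].
  have [xy|xy|->] := ltgtP x y; first exact: h.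
    by rewrite distrC [`|x - y|]distrC; exact: h.
  by rewrite !subrr normr0 mulr0.
have ch : {within `[x, y], continuous (fun u => cos (p * u + q))}.
  apply: continuous_subspaceT => u; apply: differentiable_continuous.
  by apply/derivable1_diffP; case: (is_derive_cos_affine p q u).
have [c _ hE] := MVT xy (fun u _ => is_derive_cos_affine p q u) ch.
rewrite distrC hE normrM [`|y - x|]distrC ler_wpM2r//.
by rewrite normrM normrN ler_piMr// sin_max.
Qed.

(** With [theta = 0] and [theta = pi / 2] these are the real and imaginary parts of the Fourier
    character with its negative exponent. *)
Definition wave (xi eta theta : R) (z : R * R) : R :=
  cos (2 * pi * (xi * z.1 + eta * z.2) + theta).

Lemma measurable_affine_cos p q theta :
  measurable_fun (setT : set (mR * mR)) ((fun z => cos (p * z.1 + q * z.2 + theta)) : mR * mR -> mR).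
Proof.
apply: measurableT_comp.
  by apply: continuous_measurable_fun; exact: continuous_cos.
apply: measurable_funD => //.
by apply: measurable_funD; apply: measurable_funM => //; exact: measurable_fst || exact: measurable_snd.
Qed.

Lemma measurable_wave xi eta theta :
  measurable_fun (setT : set (mR * mR)) (wave xi eta theta : mR * mR -> mR).
Proof.
have := measurable_affine_cos (2 * pi * xi) (2 * pi * eta) theta.
congr measurable_fun; apply/funext => z; rewrite /wave; congr cos; ring.
Qed.

Lemma wave_le1 xi eta theta z : `|wave xi eta theta z| <= 1.
Proof. exact: cos_max. Qed.

Definition oscillatory f xi eta theta : R :=
  Int (Int1 (fun z => f z * wave xi eta theta z)).

Lemma dom2_wave C f xi eta theta : dom2 C f ->
  dom2 C (fun z => f z * wave xi eta theta z).
Proof.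
move=> fC; rewrite -[C]mulr1.
apply: (dom2M fC); [exact: measurable_wave|exact: wave_le1].
Qed.

Lemma oscillatory_le C f xi eta theta : dom2 C f ->
  `|oscillatory f xi eta theta| <= C * Int weight ^+ 2.
Proof. by move=> /dom2_wave fC; exact: Int1_le (fC xi eta theta). Qed.

Lemma oscillatory_swap C f xi eta theta : dom2 C f ->
  oscillatory f xi eta theta = oscillatory (fun z => f (z.2, z.1)) eta xi theta.
Proof.
move=> fC; rewrite /oscillatory (Int_swap (dom2_wave xi eta theta fC)).
congr (Int (Int1 _)); apply/funext => z; rewrite /wave/=.
by rewrite [xi * _ + _]addrC.
Qed.

(* Both integrations by parts at once: the integrand of the difference is the
   derivative of [g1 * cos + p * g * sin]. *)
Lemma oscillatory_deriv2 C C1 C2 g g1 g2 xi eta theta :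
  dom2 C g -> dom2 C1 g1 -> dom2 C2 g2 ->
  (forall x y, is_derive x 1 (fun u => g (u, y)) (g1 (x, y))) ->
  (forall x y, is_derive x 1 (fun u => g1 (u, y)) (g2 (x, y))) ->
  (forall y, continuous (fun u => g2 (u, y))) ->
  oscillatory g2 xi eta theta = - (2 * pi * xi) ^+ 2 * oscillatory g xi eta theta.
Proof.
move=> gC g1C g2C dg dg1 cg2; rewrite /oscillatory.
rewrite -(IntZ _ (Int1_dom (dom2_wave xi eta theta gC))); congr Int.
apply/funext => y; rewrite /Int1.
have s0 := dom2_section y (dom2_wave xi eta theta gC).
have s2 := dom2_section y (dom2_wave xi eta theta g2C).
set p := 2 * pi * xi; pose q := 2 * pi * eta * y + theta.
have waveE x : wave xi eta theta (x, y) = cos (p * x + q).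
  by rewrite /wave/= /p /q; congr cos; ring.
rewrite -(IntZ _ s0); apply/eqP; rewrite -subr_eq0.
have s0' : dom (C * weight y * p ^+ 2) (fun x => - p ^+ 2 * (g (x, y) * wave xi eta theta (x, y))).
  have := domM s0 (measurable_cst (- p ^+ 2)) (D := p ^+ 2).
  under [X in dom _ X]eq_fun do rewrite mulrC.
  by apply => x; rewrite normrN ger0_norm// sqr_ge0.
rewrite -(IntB s2 s0'); apply/eqP.
have dom_y (D : R) h : dom2 D h -> forall x, `|h (x, y)| <= D * weight y * weight x.
  by move=> hD x; rewrite -mulrA [weight y * _]mulrC hD.2.
have cg x : {for x, continuous (fun u => g (u, y))}.
  by apply: differentiable_continuous; apply/derivable1_diffP; case: (dg x y).
apply: (@Int_derive _ (C2 * weight y + C * weight y * p ^+ 2)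
  (C1 * weight y + `|p| * (C * weight y))
  (fun x => g1 (x, y) * cos (p * x + q) + p * (g (x, y) * sin (p * x + q)))).
- move=> x.
  have h1 := is_deriveM (dg1 x y) (is_derive_cos_affine p q x).
  have h2 := is_deriveZ p (is_deriveM (dg x y) (is_derive_sin_affine p q x)).
  apply: (is_derive_eq (is_deriveD h1 h2)); rewrite waveE.
  rewrite -![_ *: _]/(_ * _).
  move: (g2 (x, y)) (g1 (x, y)) (g (x, y)) (cos _) (sin _) => *; ring.
- have cc : continuous (fun x => cos (p * x + q)).
    move=> x; apply: differentiable_continuous; apply/derivable1_diffP.
    by case: (is_derive_cos_affine p q x).
  have -> : (fun x => g2 (x, y) * wave xi eta theta (x, y) -
      - p ^+ 2 * (g (x, y) * wave xi eta theta (x, y))) =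
      (fun x => g2 (x, y) * cos (p * x + q) - - p ^+ 2 * (g (x, y) * cos (p * x + q))).
    by apply/funext => x; rewrite waveE.
  move=> x; apply: cvgB; first by apply: cvgM; [exact: cg2|exact: cc].
  by apply: cvgMr; apply: cvgM; [exact: cg|exact: cc].
- exact: domB.
- move=> x; rewrite mulrDl (le_trans (ler_normD _ _))// lerD//.
    by rewrite normrM (le_trans _ (dom_y _ _ g1C x))// ler_piMr// cos_max.
  rewrite normrM -[leRHS]mulrA; apply: ler_wpM2l => //.
  rewrite normrM (le_trans _ (dom_y _ _ gC x))// ler_piMr//.
  exact: sin_max.
Qed.

Definition Dx f : R * R -> R := fun z => 'D_(1 : R, 0 : R) f z.
Definition Dy f : R * R -> R := fun z => 'D_(0 : R, 1 : R) f z.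

Lemma is_derive_Dx f x y : differentiable f (x, y) ->
  is_derive x 1 (fun u => f (u, y)) (Dx f (x, y)).
Proof.
move=> /(@diff_derivable _ _ _ _ _ ((1, 0) : R * R)) df.
have E : (fun h : R => h^-1 *: (((fun u => f (u, y)) \o shift x) (h *: (1 : R)) - f (x, y))) =
    (fun h : R => h^-1 *: ((f \o shift (x, y)) (h *: ((1, 0) : R * R)) - f (x, y))).
  apply/funext => h /=; congr (_ *: (f _ - _)).
  by congr (_, _) => /=; rewrite ?scaler0 ?add0r.
by split; rewrite /derivable /derive /Dx E.
Qed.

Lemma is_derive_Dy f x y : differentiable f (x, y) ->
  is_derive y 1 (fun u => f (x, u)) (Dy f (x, y)).
Proof.
move=> /(@diff_derivable _ _ _ _ _ ((0, 1) : R * R)) df.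
have E : (fun h : R => h^-1 *: (((fun u => f (x, u)) \o shift y) (h *: (1 : R)) - f (x, y))) =
    (fun h : R => h^-1 *: ((f \o shift (x, y)) (h *: ((0, 1) : R * R)) - f (x, y))).
  apply/funext => h /=; congr (_ *: (f _ - _)).
  by congr (_, _) => /=; rewrite ?scaler0 ?add0r.
by split; rewrite /derivable /derive /Dy E.
Qed.

(** The four seminorms are the ones that occur when [(1 + x ^+ 2) * (1 + y ^+ 2)] is expanded. *)
Lemma schwartz_real_dom2 f a b : schwartz_real f ->
  exists C, dom2 C (partial_derivative a b f).
Proof.
move=> /(_ a b); set g := partial_derivative a b f => -[dg gC].
have [C00 h00] := gC 0%N 0%N; have [C20 h20] := gC 2%N 0%N.
have [C02 h02] := gC 0%N 2%N; have [C22 h22] := gC 2%N 2%N.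
exists (C00 + C20 + C02 + C22); split.
  by apply: continuous_plane_measurable => z; exact: differentiable_continuous.
move=> x y; rewrite /weight -invfM ler_pdivlMr; last first.
  by rewrite mulr_gt0// ltr_pwDl// sqr_ge0.
move: (h00 (x, y)) (h20 (x, y)) (h02 (x, y)) (h22 (x, y)) => /=.
rewrite !expr0 !mul1r !mulr1.
have e (u v : R) : 0 <= u -> `|u * v| = u * `|v| by move=> u0; rewrite normrM ger0_norm.
rewrite (e _ _ (mulr_ge0 (sqr_ge0 x) (sqr_ge0 y))) (e _ _ (sqr_ge0 x)) (e _ _ (sqr_ge0 y)).
move: (`|g (x, y)|) (x ^+ 2) (y ^+ 2) => G X Y; nra.
Qed.

Lemma schwartz_real_continuous f a b : schwartz_real f ->
  continuous (partial_derivative a b f).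
Proof. by move=> /(_ a b)[df _] z; exact: differentiable_continuous. Qed.

Lemma continuous_section1 g y : continuous g -> continuous (fun u => g (u, y)).
Proof.
move=> cg x; apply: (@continuous_comp _ _ _ (fun u => (u, y)) g); last exact: cg.
exact: (@cvg_pair _ _ _ (nbhs x) (nbhs x) (nbhs y) _ _ _ id (fun=> y) cvg_id (cvg_cst y)).
Qed.

Lemma continuous_section2 g x : continuous g -> continuous (fun u => g (x, u)).
Proof.
move=> cg y; apply: (@continuous_comp _ _ _ (fun u => (x, u)) g); last exact: cg.
exact: (@cvg_pair _ _ _ (nbhs y) (nbhs x) (nbhs y) _ _ _ (fun=> x) id (cvg_cst x) cvg_id).
Qed.

Let second_differences (o oxx oyy oxxyy A B : R) :
  oxx = - A * o -> oyy = - B * o -> oxxyy = - A * oyy -> 0 <= A -> 0 <= B ->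
  `|o| * ((1 + A) * (1 + B)) = `|o - oxx - oyy + oxxyy|.
Proof.
move=> -> -> -> A0 B0.
have AB0 : 0 <= (1 + A) * (1 + B) by rewrite mulr_ge0// addr_ge0.
by rewrite -{1}(ger0_norm AB0) -normrM; congr `|_|; ring.
Qed.

(** Apply [1 - Dx ^ 2] and [1 - Dy ^ 2] to [f]: the integral is multiplied by [(1 + (2 * pi * xi) ^+
    2) * (1 + (2 * pi * eta) ^+ 2)] and stays bounded. Expanding the product gives the four terms of
    [second_differences]. *)
Lemma oscillatory_decay f : schwartz_real f -> exists2 C, 0 <= C &
  forall xi eta theta, `|oscillatory f xi eta theta| <= C * (weight xi * weight eta).
Proof.
move=> sf.
pose g a b := partial_derivative a b f.
have [C00 d00] := schwartz_real_dom2 0 0 sf; have [C10 d10] := schwartz_real_dom2 1 0 sf.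
have [C20 d20] := schwartz_real_dom2 2 0 sf; have [C01 d01] := schwartz_real_dom2 0 1 sf.
have [C02 d02] := schwartz_real_dom2 0 2 sf; have [C12 d12] := schwartz_real_dom2 1 2 sf.
have [C22 d22] := schwartz_real_dom2 2 2 sf.
have xx xi eta theta : oscillatory (g 2 0) xi eta theta =
    - (2 * pi * xi) ^+ 2 * oscillatory f xi eta theta.
  apply: (oscillatory_deriv2 _ _ _ d00 d10 d20).
  - by move=> x y; apply: is_derive_Dx; exact: (sf 0 0)%N.1.
  - by move=> x y; apply: is_derive_Dx; exact: (sf 1 0)%N.1.
  - by move=> y; apply: continuous_section1; exact: schwartz_real_continuous.
have yy xi eta theta : oscillatory (g 0 2) xi eta theta =
    - (2 * pi * eta) ^+ 2 * oscillatory f xi eta theta.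
  (* Exchanging the variables reduces [y]-derivatives to the integration by parts in [x]. *)
  rewrite (oscillatory_swap _ _ _ d02) (oscillatory_swap _ _ _ d00).
  apply: (oscillatory_deriv2 _ _ _ (dom2_swap d00) (dom2_swap d01) (dom2_swap d02)).
  - by move=> x y; apply: is_derive_Dy; exact: (sf 0 0)%N.1.
  - by move=> x y; apply: is_derive_Dy; exact: (sf 0 1)%N.1.
  - by move=> y; apply: continuous_section2; exact: schwartz_real_continuous.
(* In [partial_derivative] the [x]-derivatives are the outer ones, so [g 2 2] is the second
   [x]-derivative of [g 0 2]. *)
have xxyy xi eta theta : oscillatory (g 2 2) xi eta theta =
    - (2 * pi * xi) ^+ 2 * oscillatory (g 0 2) xi eta theta.
  apply: (oscillatory_deriv2 _ _ _ d02 d12 d22).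
  - by move=> x y; apply: is_derive_Dx; exact: (sf 0 2)%N.1.
  - by move=> x y; apply: is_derive_Dx; exact: (sf 1 2)%N.1.
  - by move=> y; apply: continuous_section1; exact: schwartz_real_continuous.
exists ((C00 + C20 + C02 + C22) * Int weight ^+ 2).
  by rewrite mulr_ge0 ?sqr_ge0// !addr_ge0 ?(dom2_ge0 d00) ?(dom2_ge0 d20) ?(dom2_ge0 d02) ?(dom2_ge0 d22).
move=> xi eta theta.
rewrite /weight -invfM ler_pdivlMr; last by rewrite mulr_gt0// ltr_pwDl// sqr_ge0.
have pi2 (u : R) : 1 + u ^+ 2 <= 1 + (2 * pi * u) ^+ 2.
  by rewrite lerD2l exprMn ler_peMl ?sqr_ge0// expr_ge1//; have := pi_ge2 R; lra.
apply: (@le_trans _ _ (`|oscillatory f xi eta theta| *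
   ((1 + (2 * pi * xi) ^+ 2) * (1 + (2 * pi * eta) ^+ 2)))).
  by rewrite ler_wpM2l// ler_pM// addr_ge0// sqr_ge0.
rewrite (second_differences (xx xi eta theta) (yy xi eta theta)
  (xxyy xi eta theta) (sqr_ge0 _) (sqr_ge0 _)).
rewrite !mulrDl (le_trans (ler_normD _ _))// lerD//; last exact: oscillatory_le d22.
rewrite (le_trans (ler_normB _ _))// lerD//; last exact: oscillatory_le d02.
rewrite (le_trans (ler_normB _ _))// lerD//; last exact: oscillatory_le d20.
exact: oscillatory_le d00.
Qed.

(** The cosine is the modulation that translates the frequency lattice by [c] in the second
    coordinate. *)
Lemma schwartz_lipschitz_dom2 f c theta : schwartz_real f ->
  exists C, lipschitz_dom2 C (fun z => f z * cos (2 * pi * c * z.2 + theta)).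
Proof.
move=> sf.
have [C d] := schwartz_real_dom2 0 0 sf; have [Cx dx] := schwartz_real_dom2 1 0 sf.
have [Cy dy] := schwartz_real_dom2 0 1 sf.
have C0 := dom2_ge0 d; have Cx0 := dom2_ge0 dx; have Cy0 := dom2_ge0 dy.
(* The terms of [D] account for the size of [f], its variation in [x] and in [y] by the mean value
   theorem, and the variation of the cosine. *)
set p := 2 * pi * c; pose D := C + 3 * Cx + 3 * Cy + C * `|p|.
have Cp : 0 <= C * `|p| by rewrite mulr_ge0.
have le_D (E u : R) x y : E <= D -> 0 <= u ->
    E * u * (weight x * weight y) <= D * u * (weight x * weight y).
  by move=> ED u0; rewrite ler_wpM2r ?mulr_ge0 ?weight_ge0// ler_wpM2r.
exists D; split.
- split.
    apply: measurable_funM; first exact: d.1.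
    have := measurable_affine_cos 0 p theta; congr measurable_fun.
    by apply/funext => z; rewrite mul0r add0r.
  move=> x y; rewrite normrM (le_trans (ler_piMr _ (cos_max _)))//.
  rewrite (le_trans (d.2 x y))// ler_wpM2r ?mulr_ge0 ?weight_ge0//.
  by rewrite /D; lra.
- move=> x x' y xx'; rewrite /= -mulrBl normrM (le_trans (ler_piMr _ (cos_max _)))//.
  have h := @mvt_le (fun u => f (u, y)) (fun u => Dx f (u, y)) (Cx * weight y) x x' _ xx'.
  rewrite (le_trans (h _ _ _))//.
  + by rewrite mulr_ge0// weight_ge0.
  + by move=> u; apply: is_derive_Dx; exact: (sf 0 0)%N.1.
  + by move=> u; rewrite -mulrA [weight y * _]mulrC; exact: dx.2.
  + rewrite (_ : _ * weight x = 3 * Cx * `|x - x'| * (weight x * weight y)); last by ring.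
    by apply: le_D => //; rewrite /D; lra.
- move=> x y y' yy'.
  rewrite (_ : _ - _ = (f (x, y) - f (x, y')) * cos (p * y' + theta) +
    f (x, y) * (cos (p * y + theta) - cos (p * y' + theta))); last by rewrite /=; ring.
  have h := @mvt_le (fun u => f (x, u)) (fun u => Dy f (x, u)) (Cy * weight x) y y' _ yy'.
  rewrite (le_trans (ler_normD _ _))// !normrM.
  rewrite (le_trans (lerD (ler_piMr _ (cos_max _)) (ler_pM _ _ (d.2 x y) (ler_dist_cos _ _ _ _))))//.
  rewrite (le_trans (lerD (h _ _ _) (lexx _)))//.
  + by rewrite mulr_ge0// weight_ge0.
  + by move=> u; apply: is_derive_Dy; exact: (sf 0 0)%N.1.
  + by move=> u; rewrite -mulrA; exact: dy.2.
  + rewrite (_ : _ + _ = (3 * Cy + C * `|p|) * `|y - y'| * (weight x * weight y)); last by ring.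
    by apply: le_D => //; rewrite /D; lra.
Qed.

Lemma dom2D C D f g : dom2 C f -> dom2 D g -> dom2 (C + D) (fun z => f z + g z).
Proof.
move=> [mf fC] [mg gD]; split; first exact: measurable_funD.
by move=> x y; rewrite (le_trans (ler_normD _ _))// mulrDl lerD.
Qed.

Lemma dom2_symsum C K (u : int -> R * R -> R) : (forall k, dom2 C (u k)) ->
  dom2 (K.*2.+1%:R * C) (fun z => symsum K (fun k => u k z)).
Proof.
move=> uC; elim: K => [|K ih].
  by rewrite mul1r; under [X in dom2 _ X]eq_fun do rewrite symsum0.
under [X in dom2 _ X]eq_fun do rewrite symsumS.
have := dom2D (dom2D (uC (- K.+1%:Z)) ih) (uC K.+1%:Z).
by rewrite (_ : C + _ + C = K.+1.*2.+1%:R * C)// !natr_dbl1 -natr1; ring.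
Qed.

(** Summed under the integral sign, the waves become one kernel in each variable. The phase
    depending on [l] replaces [b * y] by [lcoord b t y]: it translates the spatial lattice by [t],
    while [c] remains as a modulation. *)
Lemma oscillatory_symsum C f a b t c theta K L : dom2 C f ->
  symsum K (fun k => symsum L (fun l =>
    oscillatory f (a * k%:~R) (b * l%:~R + c) (theta - 2 * pi * b * t * l%:~R))) =
  Int (fun y => partial_dirichlet a 0 (fun z => f z * cos (2 * pi * c * z.2 + theta)) K y *
    dirichlet L (lcoord b t y)).
Proof.
move=> fC.
pose w (k l : int) : R * R -> R := fun z => f z *
  wave (a * k%:~R) (b * l%:~R + c) (theta - 2 * pi * b * t * l%:~R) z.
have wC k l : dom2 C (w k l) by exact: dom2_wave.
transitivity (symsum K (fun k => Int (Int1 (fun z => symsum L (fun l => w k l z))))).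
  by apply: eq_symsum => k; rewrite (Int1_symsum _ (wC k)).
rewrite -(Int1_symsum _ (fun k => dom2_symsum L (wC k))).
congr Int; apply/funext => y; rewrite /Int1 /partial_dirichlet.
have FD : dom2 (C * K.*2.+1%:R) (fun z => f z * cos (2 * pi * c * z.2 + theta) *
    dirichlet K (lcoord a 0 z.1)).
  apply: dom2M => [||z]; last exact: ler_dirichlet.
    rewrite -[C]mulr1; apply: (dom2M fC) => [|z]; last exact: cos_max.
    have := measurable_affine_cos 0 (2 * pi * c) theta; congr measurable_fun.
    by apply/funext => z; rewrite mul0r add0r.
  exact: (measurable_proj1 (measurable_dirichlet_coord _ _ K)).
rewrite -(IntZr _ (dom2_section y FD)); congr Int; apply/funext => x /=.
transitivity (symsum L (fun l => symsum K (fun k => w k l (x, y)))).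
  exact: symsum_exchange.
transitivity (symsum L (fun l => f (x, y) * dirichlet K (lcoord a 0 x) *
    cos (2 * pi * l%:~R * lcoord b t y + (2 * pi * c * y + theta)))).
  apply: eq_symsum => l; rewrite -mulrA -symsum_cos -symsumZ.
  apply: eq_symsum => k; rewrite /w /wave/= /lcoord; congr (_ * cos _); ring.
by rewrite symsumZ symsum_cos; ring.
Qed.

(* The last hypothesis bounds [weight (b * l + c)] by [weight l]. *)
Lemma poisson f a b t c theta : schwartz_real f -> 1 <= a -> 1 <= b ->
  (forall l : int, `|l%:~R : R| <= `|b * l%:~R + c|) ->
  exists r : R,
  symsum N (fun k => symsum N (fun l => oscillatory f (a * k%:~R) (b * l%:~R + c)
    (theta - 2 * pi * b * t * l%:~R))) @[N --> \oo] --> r /\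
  symsum N (fun k => symsum N (fun l => f (k%:~R / a, t + l%:~R / b) *
    cos (2 * pi * c * (t + l%:~R / b) + theta))) / (a * b) @[N --> \oo] --> r.
Proof.
move=> sf a1 b1 bc; have [C fC] := schwartz_real_dom2 0 0 sf.
pose F := fun z => f z * cos (2 * pi * c * z.2 + theta).
have [D FL] := schwartz_lipschitz_dom2 c theta sf.
have [E E0 decay] := oscillatory_decay sf.
exists (lattice_integral a 0 b t F); split; last first.
  have [F2 _ _] := FL; have := @lattice_integralE _ a 0 b t a1 b1 _ _ F2.
  apply: eq_cvgn => N; rewrite symsum_exchange; congr (_ / _).
  by apply: eq_symsum => k; apply: eq_symsum => l; rewrite /= add0r.
have c1 : 1 <= 1 :> R by [].
have w1 := @symsum_node_cvg _ 1 0 c1 _ _ dom_weight.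
have w2 : symsum N (fun k => weight (k%:~R : R)) @[N --> \oo] --> Int (weight \o node 1 0).
  by apply: eq_cvgn w1 => N; rewrite divr1; apply: eq_symsum => k; rewrite divr1 add0r.
have wle (u v : R) : `|u| <= `|v| -> weight v <= weight u.
  move=> uv; rewrite -[leRHS]mul1r; apply: weight_le => //; rewrite mul1r lerD2l.
  by rewrite -[u ^+ 2]real_normK ?num_real// -[v ^+ 2]real_normK ?num_real// lerXn2r// nnegrE.
apply: (@symsum_square_cvg _ _ (fun k => E * weight (k%:~R : R))
  (fun l => weight (l%:~R : R)) (E * Int (weight \o node 1 0)) (Int (weight \o node 1 0))
  (fun K => Int (partial_dirichlet a 0 F K \o node b t))) => //.
- move=> k l; rewrite (le_trans (decay _ _ _))// -mulrA; apply: ler_wpM2l => //.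
  apply: ler_pM; rewrite ?weight_ge0//; apply: wle => //.
  by rewrite normrM ler_peMl// ger0_norm// (le_trans _ a1).
- by move=> l; exact: weight_ge0.
- move=> N; rewrite symsumZ; apply: ler_wpM2l => //.
  exact: (symsum_cvg_le N (fun k => weight_ge0 (k%:~R : R)) w2).
- move=> K; have := @partial_dirichlet_cvg _ a 0 b t b1 _ _ K FL.
  by apply: eq_cvgn => L; rewrite (oscillatory_symsum _ _ _ _ _ _ _ fC).
- exact: (@dirichlet_node_cvg _ a 0 b t a1 b1 _ _ FL).
Qed.

End oscillatory.

(** * Discrete measures *)

Lemma cvgn_congr (R : realType) (u v : nat -> R) (l l' : R) : u =1 v -> l = l' ->
  u n @[n --> \oo] --> l -> v n @[n --> \oo] --> l'.
Proof. by move=> /funext -> ->. Qed.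

Section discrete.
Context {R : realType} {T : countType}.
Notation mR := (measurableTypeR R).
Variable p : T -> R * R.
Hypothesis pI : injective p.
Implicit Types (s : seq T) (A B : set (plane R)) (t : T).

(** The list may contain more than the indices of the points of [A], so that one list serves all
    subsets of [A] simultaneously. *)
Definition covers s A := uniq s /\ forall t, A (p t) -> t \in s.

Definition locally_finite := forall r : R, exists s, covers s (eball 0 r).

(** If infinitely many nonzero masses lie in [A], the sum takes its default value 0; a locally
    finite family meets a bounded set in finitely many points. *)
Definition mass (V : zmodType) (c : T -> V) A : V := \sum_(t \in p @^-1` A) c t.

Lemma massE (V : zmodType) (c : T -> V) A s : covers s A ->
  mass c A = \sum_(t <- s | p t \in A) c t.
Proof.
move=> [us sA]; rewrite /mass.
have -> : p @^-1` A = [set` s] `&` p @^-1` A.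
  by apply/seteqP; split => [t At|t []//]; split => //; exact: sA.
rewrite fsbig_mkcondr -fsbig_seq// -big_mkcond/=.
by apply: eq_bigl => t; apply/idP/idP; rewrite !inE.
Qed.

Lemma coversW s A B : B `<=` A -> covers s A -> covers s B.
Proof. by move=> BA [us sA]; split => // t /BA/sA. Qed.

Lemma covers_bounded A : locally_finite -> bounded A -> exists s, covers s A.
Proof. by move=> lf [r Ar]; have [s /(coversW Ar)] := lf r; exists s. Qed.

Lemma sum_trivIset_if (V : zmodType) (v : V) (F : (set (plane R))^nat) z n :
  trivIset setT F -> (exists2 i, (i < n)%N & F i z) ->
  \sum_(0 <= i < n) (if z \in F i then v else 0) = v.
Proof.
move=> tF [i im Fz]; rewrite big_mkord (bigD1 (Ordinal im))//= ifT ?inE//.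
rewrite big1 ?addr0// => j ji; rewrite ifF//; apply/negP; rewrite inE => Fjz.
move/eqP: ji; apply; apply/val_inj => /=.
by apply: (tF j i I I); exists z.
Qed.

(** Only finitely many points lie in the union, so the partial sums are constant as soon as [n]
    exceeds the indices of the sets that contain them. *)
Lemma mass_sum (V : zmodType) (c : T -> V) (F : (set (plane R))^nat) s :
  trivIset setT F -> covers s (\bigcup_n F n) ->
  \forall n \near \oo, \sum_(0 <= i < n) mass c (F i) = mass c (\bigcup_n F n).
Proof.
move=> tF sF.
have [n0 hn0] : exists n0, forall t, t \in s -> (\bigcup_n F n) (p t) ->
    exists2 i, (i < n0)%N & F i (p t).
  elim: s {sF} => [|t s [n ih]]; first by exists 0%N.
  have [[i _ Fi]|nF] := pselect ((\bigcup_n F n) (p t)); last first.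
    by exists n => u; rewrite inE => /predU1P[->//|]; exact: ih.
  exists (maxn n i.+1) => u; rewrite inE => /predU1P[->|us].
    by move=> _; exists i => //; rewrite leq_max ltnSn orbT.
  by move=> /(ih _ us)[j jn Fj]; exists j => //; rewrite leq_max jn.
exists n0 => // n /= n0n; rewrite (massE c sF).
under eq_bigr => i _.
  rewrite (massE c (coversW (bigcup_sup I) sF)) big_mkcond; over.
rewrite exchange_big/= [RHS]big_mkcond/=.
apply: eq_big_seq => t ts.
have [/set_mem tF'|/negP tF'] := boolP (p t \in \bigcup_n F n).
  apply: sum_trivIset_if => //; have [i i0 Fi] := hn0 _ ts tF'.
  by exists i => //; exact: leq_trans n0n.
apply: big1 => i _; rewrite ifF//; apply/negP; rewrite inE => Fi.
by apply/tF'/mem_set; exists i.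
Qed.

Lemma mass_additive (c : T -> R[i]) : locally_finite ->
  locally_sigma_additive (mass c : set (plane R) -> R[i]^o).
Proof.
move=> lf F mF tF bF; have [s sF] := covers_bounded lf bF.
apply: cvg_near_cst; exact: mass_sum sF.
Qed.

Definition discrete_measure (lf : locally_finite) (c : T -> R[i]) :=
  ComplexMeasure (@mass_additive c lf).

Lemma normc_sum (I : Type) (r : seq I) (P : pred I) (F : I -> R[i]) :
  Normc.normc (\sum_(i <- r | P i) F i) <= \sum_(i <- r | P i) Normc.normc (F i).
Proof.
elim/big_rec2: _ => [|i y z _ h]; first by rewrite Normc.normc0.
by rewrite (le_trans (le_normcD _ _))// lerD2l.
Qed.

Lemma normc_ge0 (z : R[i]) : 0 <= Normc.normc z.
Proof. by case: z => x y; exact: sqrtr_ge0. Qed.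

(** * Variation and support of a discrete measure *)

Section variation.
Variables (lf : locally_finite) (c : T -> R[i]).
Let mu := discrete_measure lf c.

(** Used twice: with boxes it yields slow increase, and with the empty list it shows that balls
    without points are null. *)
Lemma discrete_variation_le A s : covers s A ->
  (complex_variation mu A <= (\sum_(t <- s) Normc.normc (c t))%:E)%E.
Proof.
move=> sA; apply: ge_ereal_sup => _ [F [mF bF tF UF] <-].
apply: lime_le.
  by apply: is_cvg_ereal_nneg_natsum => i _; rewrite lee_fin normc_ge0.
apply: nearW => n; rewrite sumEFin lee_fin.
apply: (@le_trans _ _ (\sum_(0 <= i < n) \sum_(t <- s | p t \in F i) Normc.normc (c t))).
  apply: ler_sum => i _; rewrite /mu/= (@massE _ _ _ s); first exact: normc_sum.
  by apply: coversW sA; rewrite -UF; exact: bigcup_sup.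
under eq_bigr do rewrite big_mkcond.
rewrite exchange_big/=; apply: ler_sum => t _.
have [[i im Fi]|nF] := pselect (exists2 i, (i < n)%N & F i (p t)).
  by rewrite sum_trivIset_if//; exists i.
rewrite big_nat big1 ?normc_ge0// => i /andP[_ im]; rewrite ifF//.
by apply/negP; rewrite inE => Fi; apply: nF; exists i.
Qed.

Lemma measurable_singleton (z : R * R) : measurable ([set z] : set (plane R)).
Proof.
rewrite (_ : [set z] = [set z.1] `*` [set z.2]); first exact: measurableX.
by apply/seteqP; case: z => x y; split => [[u v] [-> ->]//|[u v] [/= -> ->]].
Qed.

Lemma enorm_lt (z : R * R) r : enorm z < r -> `|z.1| < r /\ `|z.2| < r.
Proof.
move=> zr; have h (a b : R) : 0 <= b -> dotp z z = a ^+ 2 + b -> `|a| < r.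
  by move=> b0 e; rewrite (le_lt_trans _ zr)// /enorm e -sqrtr_sqr ler_wsqrtr// lerDl.
split; [apply: (h _ (z.2 ^+ 2))|apply: (h _ (z.1 ^+ 2))]; rewrite ?sqr_ge0//.
by rewrite /dotp !expr2 addrC.
Qed.

Lemma enorm_le (z : R * R) : enorm z <= `|z.1| + `|z.2|.
Proof.
rewrite /enorm -[leRHS]ger0_norm ?addr_ge0// -sqrtr_sqr ler_wsqrtr//.
rewrite /dotp -!expr2 -[z.1 ^+ 2]real_normK ?num_real// -[z.2 ^+ 2]real_normK ?num_real//.
have := normr_ge0 z.1; have := normr_ge0 z.2; nra.
Qed.

Lemma enorm_gt0 (z : R * R) : z <> 0 -> 0 < enorm z.
Proof.
case: z => x y xy0; rewrite /enorm sqrtr_gt0 /dotp/= -!expr2.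
rewrite lt_def addr_ge0 ?sqr_ge0// andbT paddr_eq0 ?sqr_ge0// !sqrf_eq0.
by apply/negP => /andP[/eqP x0 /eqP y0]; apply: xy0; rewrite x0 y0.
Qed.

Lemma bounded_eball (x : R * R) (r : R) : bounded (eball x r).
Proof.
exists (r + r + `|x.1| + `|x.2|) => y /enorm_lt[/= y1 y2].
rewrite /eball/= subr0 (le_lt_trans (enorm_le _))//.
have h (a b : R) : `|a| <= `|a - b| + `|b| by rewrite -{1}(subrK b a) ler_normD.
have := h y.1 x.1; have := h y.2 x.2; lra.
Qed.

Lemma measurable_eball (x : R * R) (r : R) : measurable (eball x r).
Proof.
rewrite (_ : eball x r = (fun y : plane R => enorm (y - x)) @^-1` [set` `]-oo, r[]); last first.
  by apply/seteqP; split => y; rewrite /= in_itv.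
rewrite -[X in measurable X]setTI.
have : measurable_fun (setT : set (plane R)) (fun y : plane R => enorm (y - x) : mR).
  apply: (@measurableT_comp _ _ _ _ _ _ (@Num.sqrt R : mR -> mR)).
    by apply: continuous_measurable_fun; exact: sqrt_continuous.
  by apply: measurable_funD; apply: measurable_funM; apply: measurable_funB => //;
    (exact: measurable_fst || exact: measurable_snd).
by apply => //; exact: measurable_itv.
Qed.

Lemma discrete_supp_sub g : 0 < g -> (forall u t, u <> t -> g <= enorm (p u - p t)) ->
  supp mu `<=` range p.
Proof.
move=> g0 pg x xs; apply: contrapT => xp.
(* A ball of radius [g / 4] contains at most one point: two of them would differ by less than
   [g / 2] in each coordinate, hence by less than [g]. If there is one, shrink the ball to exclude
   it. *)
have [r r0 rx] : exists2 r, 0 < r & forall t, ~ eball x r (p t).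
  have [[t tx]|nt] := pselect (exists t, eball x (g / 4) (p t)); last first.
    by exists (g / 4) => [|t tx]; [rewrite divr_gt0|apply: nt; exists t].
  exists (Num.min (g / 4) (enorm (p t - x))).
    rewrite lt_min divr_gt0//= enorm_gt0// => /eqP; rewrite subr_eq0 => /eqP pt.
    by apply: xp; exists t.
  move=> u; rewrite /eball/= lt_min => /andP[ux ut].
  have [ut'|/eqP utn] := eqVneq u t; first by rewrite ut' ltxx in ut.
  have := pg _ _ utn; apply/negP; rewrite -ltNge (le_lt_trans (enorm_le _))//=.
  have [/= u1 u2] := enorm_lt ux; have [/= t1 t2] := enorm_lt tx.
  have h (a b d : R) : `|a - b| <= `|a - d| + `|b - d|.
    by rewrite (_ : a - b = (a - d) - (b - d)) ?ler_normB//; ring.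
  have := h (p u).1 (p t).1 x.1; have := h (p u).2 (p t).2 x.2; lra.
have := xs _ r0; apply/negP; rewrite -leNgt.
apply: le_trans (@discrete_variation_le _ [::] _) _; last by rewrite big_nil.
by split => // t /rx.
Qed.

Lemma discrete_supp_sup : (forall t, c t != 0) -> range p `<=` supp mu.
Proof.
move=> c0 _ [t _ <-] r r0.
(* Isolating the point in the partition of the ball makes the first term of the series already
   positive. *)
pose F n : set (plane R) := if n is 0 then [set p t] else
  if n is 1 then eball (p t) r `\ p t else set0.
have ptr : eball (p t) r (p t) by rewrite /eball/= subrr /enorm /dotp/= mulr0 addr0 sqrtr0.
apply: (@lt_le_trans _ _ (Normc.normc (c t))%:E).
  rewrite lte_fin lt_def normc_ge0 andbT; apply/eqP => /Normc.eq0_normc/eqP.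
  by apply/negP.
have -> : (Normc.normc (c t))%:E = (\sum_(0 <= i < 1) (Normc.normc (mu (F i)))%:E)%E.
  rewrite big_nat1 /mu/= (@massE _ _ _ [:: t]).
    by rewrite big_mkcond big_seq1 ifT// inE.
  by split => // u /pI ->; rewrite inE.
apply: (@le_trans _ _ (\sum_(0 <= i <oo) (Normc.normc (mu (F i)))%:E)%E).
  by apply: nneseries_lim_ge => n _ _; rewrite lee_fin normc_ge0.
apply: ereal_sup_ubound; exists F => //; split.
- case=> [|[|n]]; [exact: measurable_singleton| |exact: measurable0].
  by apply: measurableD; [exact: measurable_eball|exact: measurable_singleton].
- have := @bounded_eball (p t) r.
  by case=> d bd [|[|n]]; exists d => // y; [move=> ->; exact: bd|case=> + _; exact: bd].
- move=> [|[|i]] [|[|j]] _ _ [y []]//=; [by move=> -> []|by move=> [_ h] /h].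
- apply/seteqP; split => [y [[|[|n]] _ //=]|y yr]; [by move=> ->|by case|].
  by have [->|yt] := pselect (y = p t); [exists 0%N|exists 1%N].
Qed.
End variation.

(** * Integration against discrete measures *)

Section integration.
(** Abstracts from [discrete_measure] so that real parts, imaginary parts and their opposites are
    treated alike. *)
Definition atomic (nu : signed_measure R) (d : T -> R) := forall A s, covers s A ->
  nu A = \sum_(t <- s | p t \in A) d t.

Lemma Re_discrete_atomic lf c : atomic (Re_measure (discrete_measure lf c)) (@complex.Re R \o c).
Proof.
move=> A s sA; rewrite /= (massE c sA).
by rewrite (big_morph (@complex.Re R) (id1 := 0) (op1 := +%R))// => -[? ?] [].
Qed.

Lemma Im_discrete_atomic lf c : atomic (Im_measure (discrete_measure lf c)) (@complex.Im R \o c).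
Proof.
move=> A s sA; rewrite /= (massE c sA).
by rewrite (big_morph (@complex.Im R) (id1 := 0) (op1 := +%R))// => -[? ?] [].
Qed.

Lemma opp_atomic nu d : atomic nu d -> atomic (opp_measure nu) (fun t => - d t).
Proof. by move=> nud A s sA; rewrite /= sumrN -(nud A s sA). Qed.

Variable X : nat -> seq T.
Hypotheses (uX : forall n, uniq (X n))
  (ndX : forall m n, (m <= n)%N -> {subset X m <= X n})
  (coverX : forall t, exists n, t \in X n).
Variables (nu : signed_measure R) (d : T -> R).
Hypothesis nud : atomic nu d.
Let m := upper_variation nu.

(** The supremum chooses between the empty set and the singleton. *)
Lemma upper_variation_atom t : m [set p t] = (Num.max (d t) 0)%:E.
Proof.
have nuB B : B `<=` [set p t] -> nu B = if p t \in B then d t else 0.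
  move=> Bt; rewrite (@nud B [:: t]); first by rewrite big_mkcond big_seq1.
  by split => // u /Bt/pI ->; rewrite inE.
apply/eqP; rewrite eq_le; apply/andP; split.
  apply: ge_ereal_sup => _ [B [_ _ /nuB ->] <-].
  by rewrite lee_fin le_max; case: ifPn; rewrite lexx ?orbT.
have [d0|d0] := leP 0 (d t).
  apply: ereal_sup_ubound; exists [set p t]; last by rewrite nuB// ifT ?inE.
  split => //; first exact: measurable_singleton.
  have [r br] := @bounded_eball (p t) 1; exists r => _ ->; apply: br.
  by rewrite /eball/= subrr /enorm /dotp/= mulr0 addr0 sqrtr0.
exact: measure_ge0.
Qed.

Lemma upper_variation_off : m (~` range p) = 0%E.
Proof.
apply/eqP; rewrite eq_le measure_ge0 andbT; apply: ge_ereal_sup => _ [B [_ _ Bp] <-].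
rewrite (@nud B [::]) ?big_nil//; split => // t /Bp nt.
by exfalso; apply: nt; exists t.
Qed.

Lemma measurable_range (S : set T) : measurable (p @` S : set (plane R)).
Proof.
apply: countable_measurable; first exact: measurable_singleton.
exact: (card_le_trans (card_image_le _ _) (countableP _)).
Qed.

Lemma integral_finite (f : R * R -> \bar R) s : uniq s ->
  measurable_fun setT (f : plane R -> \bar R) -> (forall x, 0 <= f x)%E ->
  (\int[m]_(x in p @` [set` s]) f x = \sum_(t <- s) (Num.max (d t) 0)%:E * f (p t))%E.
Proof.
move=> + mf f0; elim: s => [_|t s ih /= /andP[ts us]].
  by rewrite big_nil set_nil image_set0 integral_set0.
rewrite big_cons -ih//.
have -> : p @` [set` t :: s] = [set p t] `|` p @` [set` s].
  apply/seteqP; split => [_ [u /= + <-]|y [->|[u us' <-]]].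
  - by rewrite inE => /predU1P[->|us']; [left|right; exists u].
  - by exists t => //=; rewrite inE eqxx.
  - by exists u => //=; rewrite inE us' orbT.
rewrite ge0_integral_setU//; last 4 first.
- exact: measurable_singleton.
- exact: measurable_range.
- exact: measurable_funTS.
- by apply/disj_setPS => _ [-> [u us' /pI ut]]; move: ts; rewrite -ut us'.
congr (_ + _)%E; transitivity (\int[m]_(x in [set p t]) cst (f (p t)) x)%E.
  by apply: eq_integral => y; rewrite inE => ->.
rewrite (integral_cst _ (measurable_singleton (p t))) muleC; congr (_ * _)%E.
exact: upper_variation_atom.
Qed.

(** Monotone convergence along the finite sets [p @] [set[X n]], whose union carries the whole upper
    variation. The exhaustion [X] will be the boxes, matching the partial sums in Poisson
    summation. *)
Lemma ge0_integral_atomic_cvg (f : R * R -> \bar R) :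
  measurable_fun setT (f : plane R -> \bar R) -> (forall x, 0 <= f x)%E ->
  (\sum_(t <- X n) (Num.max (d t) 0)%:E * f (p t))%E @[n --> \oo] --> (\int[m]_x f x)%E.
Proof.
move=> mf f0.
rewrite (@ge0_negligible_integral _ _ _ m _ (~` range p))//; last 2 first.
- by apply: measurableC; exact: measurable_range.
- exact: upper_variation_off.
rewrite setTD setCK.
have -> : range p = \bigcup_n p @` [set` X n].
  apply/seteqP; split => [_ [t _ <-]|_ [n _ [t _ <-]]]; last by exists t.
  by have [n tn] := coverX t; exists n => //; exists t.
have -> : (fun n => \sum_(t <- X n) (Num.max (d t) 0)%:E * f (p t))%E =
    (fun n => \int[m]_(x in p @` [set` X n]) f x)%E.
  by apply/funext => n; rewrite integral_finite.
apply: ge0_nondecreasing_set_cvg_integral => //.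
- by move=> i j ij; apply/subsetPset => _ [t ti <-]; exists t => //; exact: ndX ti.
- by move=> i; exact: measurable_range.
- by move=> i; exact: measurable_funTS.
Qed.

(** The uniform bound [C] makes the integrals of the positive and negative parts of [h] finite, so
    that [fine] returns their true values and they may be subtracted. *)
Lemma Rintegral_atomic_cvg (h : R * R -> R) (C : R) :
  measurable_fun setT (h : plane R -> mR) ->
  (forall n, \sum_(t <- X n) `|d t| * `|h (p t)| <= C) ->
  \sum_(t <- X n) Num.max (d t) 0 * h (p t) @[n --> \oo] --> \int[m]_x h x.
Proof.
move=> mh hC.
have pos (g : R * R -> R) : measurable_fun setT (g : plane R -> mR) ->
    (forall x, 0 <= g x <= `|h x|) ->
    \sum_(t <- X n) Num.max (d t) 0 * g (p t) @[n --> \oo] --> \int[m]_x g x /\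
    (\int[m]_x (g x)%:E)%E \is a fin_num.
  move=> mg gh.
  have gc : (\sum_(t <- X n) (Num.max (d t) 0)%:E * (g (p t))%:E)%E @[n --> \oo] -->
      (\int[m]_x (g x)%:E)%E.
    apply: ge0_integral_atomic_cvg; first exact/measurable_EFinP.
    by move=> x; rewrite lee_fin; case/andP: (gh x).
  have E n : (\sum_(t <- X n) (Num.max (d t) 0)%:E * (g (p t))%:E)%E =
      (\sum_(t <- X n) Num.max (d t) 0 * g (p t))%:E by rewrite -sumEFin.
  have fn : (\int[m]_x (g x)%:E)%E \is a fin_num.
    rewrite ge0_fin_numE; last by apply: integral_ge0 => x _; rewrite lee_fin; case/andP: (gh x).
    apply: (@le_lt_trans _ _ C%:E); last exact: ltry.
    rewrite -(cvg_lim _ gc)//; apply: lime_le; first by apply/cvg_ex; eexists; exact: gc.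
    apply: nearW => n; rewrite E lee_fin (le_trans _ (hC n))//; apply: ler_sum => t _.
    have /andP[g0 gh'] := gh (p t); apply: ler_pM => //; first by rewrite le_max lexx orbT.
    by rewrite ge_max ler_norm normr_ge0.
  split=> //; rewrite /Rintegral.
  have gc' : (\sum_(t <- X n) Num.max (d t) 0 * g (p t))%:E @[n --> \oo] -->
      (fine (\int[m]_x (g x)%:E)%E)%:E.
    by rewrite fineK// -(funext E).
  exact: (fine_cvg gc').
have m0 : measurable_fun setT ((cst 0) : plane R -> mR) by exact: measurable_cst.
pose hp x := Num.max (h x) 0; pose hn x := Num.max (- h x) 0.
have [|x|cp fp] := pos hp.
- exact: measurable_maxr.
- by rewrite /hp le_max lexx orbT/= ge_max ler_norm normr_ge0.
have [|x|cn fn] := pos hn.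
- by apply: measurable_maxr => //; exact: measurableT_comp.
- by rewrite /hn le_max lexx orbT/= ge_max -normrN ler_norm normr_ge0.
have -> : \int[m]_x h x = \int[m]_x hp x - \int[m]_x hn x.
  rewrite /Rintegral -fineB// integralE; congr (fine (_ - _)).
  - by apply: eq_integral => x _; rewrite funeposE /hp EFin_max.
  - by apply: eq_integral => x _; rewrite funenegE /hn EFin_max.
apply: eq_cvgn (cvgB cp cn) => n.
rewrite -[LHS]sumrB; apply: eq_bigr => t _; rewrite -mulrBr; congr (_ * _).
by rewrite /hp /hn; case: (leP (h (p t)) 0) => ?; case: (leP (- h (p t)) 0) => ?; lra.
Qed.
End integration.

Section exhaustion.
Variable X : nat -> seq T.
Hypotheses (uX : forall n, uniq (X n))
  (ndX : forall m n, (m <= n)%N -> {subset X m <= X n})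
  (coverX : forall t, exists n, t \in X n).

Lemma signed_part_cvg nu d (h : R * R -> R) (C : R) : atomic nu d ->
  measurable_fun setT (h : plane R -> mR) ->
  (forall n, \sum_(t <- X n) `|d t| * `|h (p t)| <= C) ->
  \sum_(t <- X n) d t * h (p t) @[n --> \oo] -->
    \int[upper_variation nu]_x h x - \int[upper_variation (opp_measure nu)]_x h x.
Proof.
move=> nud mh hC.
have cp := Rintegral_atomic_cvg uX ndX coverX nud mh hC.
have cn : \sum_(t <- X n) Num.max (- d t) 0 * h (p t) @[n --> \oo] -->
    \int[upper_variation (opp_measure nu)]_x h x.
  apply: (Rintegral_atomic_cvg uX ndX coverX (opp_atomic nud) mh (C := C)) => n.
  by under eq_bigr do rewrite normrN.
apply: eq_cvgn (cvgB cp cn) => n.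
rewrite -[LHS]sumrB; apply: eq_bigr => t _; rewrite -mulrBl; congr (_ * _).
by case: (leP (d t) 0) => ?; case: (leP (- d t) 0) => ?; lra.
Qed.

Lemma integral_discrete_cvg lf c (f : R * R -> R[i]) (C : R) :
  measurable_fun setT ((@complex.Re R \o f) : plane R -> mR) ->
  measurable_fun setT ((@complex.Im R \o f) : plane R -> mR) ->
  (forall n, \sum_(t <- X n) Normc.normc (c t) * Normc.normc (f (p t)) <= C) ->
  complex.Re (\sum_(t <- X n) c t * f (p t)) @[n --> \oo] -->
    complex.Re (integral_complex (discrete_measure lf c) f) /\
  complex.Im (\sum_(t <- X n) c t * f (p t)) @[n --> \oo] -->
    complex.Im (integral_complex (discrete_measure lf c) f).
Proof.
move=> mRe mIm fC.
have Re_le (z : R[i]) : `|complex.Re z| <= Normc.normc z.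
  by case: z => x y /=; rewrite -sqrtr_sqr ler_wsqrtr// lerDl sqr_ge0.
have Im_le (z : R[i]) : `|complex.Im z| <= Normc.normc z.
  by case: z => x y /=; rewrite -sqrtr_sqr ler_wsqrtr// lerDr sqr_ge0.
have bnd (q r : R[i] -> R) : (forall z, `|q z| <= Normc.normc z) ->
    (forall z, `|r z| <= Normc.normc z) ->
    forall n, \sum_(t <- X n) `|q (c t)| * `|r (f (p t))| <= C.
  by move=> hq hr n; rewrite (le_trans _ (fC n))//; apply: ler_sum => t _; exact: ler_pM.
have rr := signed_part_cvg (Re_discrete_atomic lf c) mRe (bnd _ _ Re_le Re_le).
have ri := signed_part_cvg (Re_discrete_atomic lf c) mIm (bnd _ _ Re_le Im_le).
have ir := signed_part_cvg (Im_discrete_atomic lf c) mRe (bnd _ _ Im_le Re_le).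
have ii := signed_part_cvg (Im_discrete_atomic lf c) mIm (bnd _ _ Im_le Im_le).
split.
- apply: (cvgn_congr _ _ (cvgB rr ii)) => [n|]; last first.
    by rewrite /integral_complex /integral_signed /integralC /= mul0r mul1r sub0r.
  rewrite (big_morph (@complex.Re R) (id1 := 0) (op1 := +%R)) => [|[? ?] []//|//].
  rewrite -[LHS]sumrB; apply: eq_bigr => t _ /=.
  by case: (c t) (f (p t)) => [a b] [u v].
- apply: (cvgn_congr _ _ (cvgD ri ir)) => [n|]; last first.
    by rewrite /integral_complex /integral_signed /integralC /= mul0r mul1r add0r.
  rewrite (big_morph (@complex.Im R) (id1 := 0) (op1 := +%R)) => [|[? ?] []//|//].
  rewrite -[LHS]big_split; apply: eq_bigr => t _ /=.
  by case: (c t) (f (p t)) => [a b] [u v].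
Qed.
End exhaustion.
End discrete.

(** * Lattice rows *)

Section grid.
Context {R : realType}.

(** The flag tells odd rows from even ones; the integers are the position in the row and the number
    of the row. *)
Definition site : countType := (bool * int * int)%type.

Definition interval_int (N : nat) : seq int := [seq (i : nat)%:Z - N%:Z | i : 'I_N.*2.+1].

Definition box (N : nat) : seq site :=
  [seq (bm, n) | bm <- [seq (b, m) | b <- [:: false; true], m <- interval_int N],
    n <- interval_int N].

Lemma mem_interval_int N (m : int) : (m \in interval_int N) = (`|m|%N <= N)%N.
Proof.
apply/mapP/idP => [[i _ ->]|mN]; first by have := ltn_ord i; lia.
exists (inord (absz (m + N%:Z))); rewrite ?mem_enum// inordK; lia.
Qed.

Lemma uniq_interval_int N : uniq (interval_int N).
Proof. by rewrite map_inj_uniq ?enum_uniq// => i j /addIr[] /val_inj. Qed.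

Lemma uniq_box N : uniq (box N).
Proof.
apply: allpairs_uniq; [|exact: uniq_interval_int|by move=> [? ?] [? ?] _ _ [-> ->]].
by apply: allpairs_uniq; [|exact: uniq_interval_int|move=> [? ?] [? ?] _ _ [-> ->]].
Qed.

Lemma mem_box N (b : bool) (m n : int) :
  (((b, m), n) \in box N) = (`|m|%N <= N)%N && (`|n|%N <= N)%N.
Proof.
rewrite -!mem_interval_int; apply/allpairsP/andP => [[[bm' n'] [/= hbm hn [e1 e2]]]|[mN nN]].
  split; last by rewrite e2.
  by move: hbm; rewrite /= cats0 -e1 mem_cat => /orP[] /mapP[? hm [_ ->]].
exists ((b, m), n); split => //; apply/allpairsP; exists (b, m); split => //.
by case: (b).
Qed.

Lemma box_mono M N : (M <= N)%N -> {subset box M <= box N}.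
Proof. by move=> MN [[b m] n]; rewrite !mem_box; lia. Qed.

Lemma box_cover (t : site) : exists N, t \in box N.
Proof. by case: t => -[b m] n; exists (`|m| + `|n|)%N; rewrite mem_box; lia. Qed.

Lemma sum_interval_int N (f : int -> R) : \sum_(m <- interval_int N) f m = symsum N f.
Proof. by rewrite /symsum big_map big_enum. Qed.

Lemma sum_box N (f : site -> R) : \sum_(t <- box N) f t =
  symsum N (fun m => symsum N (fun n => f ((false, m), n))) +
  symsum N (fun m => symsum N (fun n => f ((true, m), n))).
Proof.
rewrite /box big_allpairs_dep/= cats0 big_cat/=.
have h b : \sum_(i <- [seq (b, m) | m <- interval_int N]) \sum_(n <- interval_int N) f (i, n) =
    symsum N (fun m => symsum N (fun n => f ((b, m), n))).
  by rewrite big_map sum_interval_int; apply: eq_symsum => m; rewrite sum_interval_int.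
by rewrite !h.
Qed.

Lemma size_box N : (size (box N) = 2 * N.*2.+1 ^ 2)%N.
Proof. by rewrite !size_allpairs size_map size_enum_ord/=; lia. Qed.

Lemma sum_box_weight : exists2 B, 0 <= B & forall N (f : site -> R) E,
  0 <= E -> (forall b m n, f ((b, m), n) <= E * (weight m%:~R * weight n%:~R)) ->
  \sum_(t <- box N) f t <= E * B.
Proof.
have w1 := @symsum_node_cvg R 1 0 (lexx 1) _ _ dom_weight.
have w2 : symsum N (fun k => weight (k%:~R : R)) @[N --> \oo] --> Int (weight \o node 1 0).
  by apply: eq_cvgn w1 => N; rewrite divr1; apply: eq_symsum => k; rewrite divr1 add0r.
have w3 N := symsum_cvg_le N (fun k => weight_ge0 (k%:~R : R)) w2.
have w0 N : 0 <= symsum N (fun k => weight (k%:~R : R)).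
  by apply: sumr_ge0 => i _; exact: weight_ge0.
have B0 := le_trans (w0 0%N) (w3 0%N).
exists (2 * Int (weight \o node 1 0) ^+ 2); first by rewrite mulr_ge0// sqr_ge0.
move=> N f E E0 fE; rewrite sum_box.
have h b : symsum N (fun m => symsum N (fun n => f ((b, m), n))) <=
    E * Int (weight \o node 1 0) ^+ 2.
  apply: (@le_trans _ _ (symsum N (fun m => symsum N (fun n =>
      E * (weight m%:~R * weight n%:~R))))).
    by apply: ler_symsum => m; apply: ler_symsum => n.
  have -> : symsum N (fun m => symsum N (fun n => E * (weight m%:~R * weight n%:~R))) =
      E * (symsum N (fun k => weight (k%:~R : R)) * symsum N (fun k => weight (k%:~R : R))).
    rewrite -symsumZr -symsumZ; apply: eq_symsum => m.
    by rewrite -symsumZ -symsumZ.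
  by rewrite ler_wpM2l// expr2 ler_pM.
by have := h false; have := h true; lra.
Qed.

Variables (al : bool -> R) (be a0 : R).
Hypotheses (a00 : 0 < a0) (a0al : forall b, a0 <= al b) (a0be : a0 <= be).

(** Odd rows lie halfway between even ones. With [be = 2] their heights are [2 n + 1], with
    [be = 1 / 2] they are [n / 2 + 1 / 4], so one family describes the support on both sides. *)
Definition grid (t : site) : R * R :=
  (al t.1.1 * t.1.2%:~R, be * (t.2%:~R + (t.1.1 : nat)%:R / 2)).

Lemma int_lt1 (k : int) : `|k%:~R : R| < 1 -> k = 0.
Proof. by rewrite -intr_norm -[1]/(1%:~R) ltr_int; lia. Qed.

(** Heights are [be / 2] times the integers [2 n + b]. Heights closer than [a0 / 2] therefore
    coincide, parity recovers [b] and then [n], and within a row the spacing is at least [a0]. *)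
Lemma grid_separated u t : u <> t -> a0 / 2 <= enorm (grid u - grid t).
Proof.
case: u t => -[b m] n [[b' m'] n'] ut; rewrite leNgt; apply/negP => /enorm_lt[/=].
have small (c x : R) : a0 <= c -> `|c * x| < a0 / 2 -> `|x| < 2^-1.
  move=> ac; rewrite normrM gtr0_norm ?(lt_le_trans a00)// => h.
  rewrite ltNge; apply/negP => x2; move: h; apply/negP; rewrite -leNgt.
  by apply: ler_pM => //; exact: ltW.
move=> h1; rewrite -mulrBr => /(small _ _ a0be) h2.
have dE : `|(2 * (n - n') + ((b : nat)%:Z - (b' : nat)%:Z))%:~R : R| < 1.
  rewrite (_ : _%:~R = 2 * (n%:~R + (b : nat)%:R / 2 - (n'%:~R + (b' : nat)%:R / 2))).
    by rewrite normrM ger0_norm//; lra.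
  rewrite !(intrD, intrM, intrB, rmorphN) /= -[(b : nat)%:~R]/((b : nat)%:R).
  by rewrite -[(b' : nat)%:~R]/((b' : nat)%:R) -[1%:~R]/(1 : R); field.
move/int_lt1 : dE => dE.
have bb' : b = b' by move: dE; case: (b); case: (b') => /= ?; lia.
have nn' : n = n' by move: dE; rewrite bb'; lia.
apply: ut; rewrite bb' nn'; congr (_, _, _).
move: h1; rewrite bb' -mulrBr => /(small _ _ (a0al _)).
rewrite -intrB => h; have /int_lt1 : `|(m - m')%:~R : R| < 1 by lra.
lia.
Qed.

Lemma grid_inj : injective grid.
Proof.
move=> u t ut; apply: contrapT => /grid_separated.
by rewrite ut subrr /enorm /dotp/= mulr0 addr0 sqrtr0 leNgt divr_gt0.
Qed.

Lemma grid_covers r N : r / a0 + 1 <= N%:R -> covers grid (box N) (eball 0 r).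
Proof.
move=> rN; split; first exact: uniq_box.
move=> [[b m] n]; rewrite /eball/= subr0 => /enorm_lt[/= h1 h2].
have small (c x : R) : a0 <= c -> `|c * x| < r -> `|x| < r / a0.
  move=> ac; rewrite normrM gtr0_norm ?(lt_le_trans a00)// => h.
  by rewrite ltr_pdivlMr// (le_lt_trans _ h)// mulrC ler_wpM2r.
have toN (k : int) : `|k%:~R : R| <= N%:R -> (`|k|%N <= N)%N.
  by rewrite -intr_norm -[N%:R]/(N%:~R) ler_int; lia.
rewrite mem_box; apply/andP; split; apply: toN.
  by have := small _ _ (a0al b) h1; lra.
have /ltr_normlP[n1 n2] := small _ _ a0be h2.
by rewrite ler_norml; apply/andP; move: n1 n2; case: (b) => /= *; split; lra.
Qed.

Lemma grid_locally_finite : locally_finite grid.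
Proof.
move=> r; exists (box (Num.truncn (r / a0 + 1)).+1); apply: grid_covers.
exact/ltW/truncnS_gt.
Qed.

Lemma grid_slowly_increasing (c : site -> R[i]) :
  (forall t, Normc.normc (c t) <= 1) ->
  slowly_increasing (discrete_measure grid_locally_finite c).
Proof.
move=> c1; exists 2%:R, (2 * (2 / a0 + 7) ^+ 2); near=> r.
have r1 : 1 <= r by near: r; exact: nbhs_pinfty_ge.
pose N := (Num.truncn (r / a0 + 1)).+1.
have rN : r / a0 + 1 <= N%:R by exact/ltW/truncnS_gt.
have ra : 0 <= r / a0 by rewrite divr_ge0 ?(ltW a00)//; lra.
have Nr : N%:R <= r / a0 + 2.
  rewrite /N -natr1; have : (Num.truncn (r / a0 + 1))%:R <= r / a0 + 1.
    by rewrite truncn_le//; lra.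
  lra.
apply: le_trans (discrete_variation_le _ _ (grid_covers rN)) _.
rewrite lee_fin (le_trans (ler_sum _ (fun t _ => c1 t)))//.
rewrite big_const_seq count_predT iter_addr addr0 size_box.
rewrite powR_mulrn; last by lra.
rewrite natrM natrX natr_dbl1.
have a0i : 0 <= a0^-1 by rewrite invr_ge0 ltW.
have h : 2 * N%:R + 1 <= (2 / a0 + 7) * r by move: Nr a0i; rewrite /=; nra.
rewrite -mulrA ler_wpM2l// -exprMn lerXn2r// nnegrE; first by have := ler0n R N; lra.
by rewrite mulr_ge0 ?addr_ge0 ?mulr_ge0//; lra.
Unshelve. all: by end_near. Qed.

End grid.

(** * The Fourier transform in terms of oscillatory integrals *)

Section fourier_transform.
Context {R : realType}.
Notation mR := (measurableTypeR R).
Notation leb2 := (@lebesgue_measure R \x @lebesgue_measure R)%E.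
Implicit Types u v : R * R -> R.

Lemma oscillatoryE C u xi eta theta : dom2 C u ->
  oscillatory u xi eta theta = \int[leb2]_z (u z * wave xi eta theta z).
Proof. by move=> uC; exact: (Int1E (dom2_wave xi eta theta uC)). Qed.

Lemma schwartz_dom2 u : schwartz_real u -> exists C, dom2 C u.
Proof. exact: (@schwartz_real_dom2 _ u 0 0). Qed.

Lemma schwartz_measurable u : schwartz_real u ->
  measurable_fun (setT : set (plane R)) (u : plane R -> mR).
Proof. by move=> /schwartz_dom2[C []]. Qed.

Lemma fourierE (f : R * R -> R[i]) y : schwartz f ->
  fourier f y =
    ((oscillatory (@complex.Re R \o f) y.1 y.2 0 -
      oscillatory (@complex.Im R \o f) y.1 y.2 (pi / 2)) +i*
     (oscillatory (@complex.Re R \o f) y.1 y.2 (pi / 2) +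
      oscillatory (@complex.Im R \o f) y.1 y.2 0))%C.
Proof.
move=> [/schwartz_dom2[C uC] /schwartz_dom2[D vD]].
rewrite !(oscillatoryE _ _ _ uC) !(oscillatoryE _ _ _ vD).
have iu theta := dom2_integrable (dom2_wave y.1 y.2 theta uC).
have iv theta := dom2_integrable (dom2_wave y.1 y.2 theta vD).
rewrite /fourier /integralC -(RintegralB _ (iu 0) (iv (pi / 2)))//.
rewrite -(RintegralD _ (iu (pi / 2)) (iv 0))//.
have dotE x : 2 * pi * (y.1 * x.1 + y.2 * x.2) = 2 * pi * dotp x y.
  by rewrite /dotp; ring.
congr (_ +i* _)%C; apply: eq_Rintegral => x _;
  rewrite /wave /cis /= dotE addr0 cosDpihalf cosN sinN;
  by case: (f x) => a b /=; ring.
Qed.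

(** Tonelli applies to the positive and negative parts separately, and the integral is by definition
    [fine] of their difference. *)
Lemma measurable_Int d (S : measurableType d) (G : S * mR -> mR) :
  measurable_fun setT G -> measurable_fun setT ((fun t => Int (fun x => G (t, x))) : S -> mR).
Proof.
move=> mG; have mG' : measurable_fun setT (EFin \o G) by exact/measurable_EFinP.
have e t : Int (fun x => G (t, x)) =
    fine (fubini_F (@lebesgue_measure R) (EFin \o G)^\+%E t -
          fubini_F (@lebesgue_measure R) (EFin \o G)^\-%E t)%E.
  rewrite /Int /Rintegral integralE; congr (fine (_ - _)).
  - by apply: eq_integral => x _; rewrite !funeposE.
  - by apply: eq_integral => x _; rewrite !funenegE.
rewrite (funext e); apply: (measurableT_comp (fine_measurable measurableT)).
apply: emeasurable_funB.
- by apply: measurable_fun_fubini_tonelli_F => //; exact: measurable_funepos.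
- by apply: measurable_fun_fubini_tonelli_F => //; exact: measurable_funeneg.
Qed.

Lemma measurable_oscillatory u theta : schwartz_real u ->
  measurable_fun (setT : set (plane R))
    ((fun y => oscillatory u y.1 y.2 theta) : plane R -> mR).
Proof.
move=> su; have [C uC] := schwartz_dom2 su.
pose G (w : plane R * mR * mR) : mR :=
  u (w.2, w.1.2) * wave w.1.1.1 w.1.1.2 theta (w.2, w.1.2).
suff mG : measurable_fun setT G.
  exact: (measurable_Int (measurable_Int mG)).
have m1 : measurable_fun setT (fun w : plane R * mR * mR => w.1.1.1).
  apply: (measurableT_comp measurable_fst).
  by apply: (measurableT_comp measurable_fst); exact: measurable_fst.
have m2 : measurable_fun setT (fun w : plane R * mR * mR => w.1.1.2).
  apply: (measurableT_comp measurable_snd).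
  by apply: (measurableT_comp measurable_fst); exact: measurable_fst.
have m3 : measurable_fun setT (fun w : plane R * mR * mR => w.1.2).
  by apply: (measurableT_comp measurable_snd); exact: measurable_fst.
have m4 : measurable_fun setT (fun w : plane R * mR * mR => w.2).
  exact: measurable_snd.
apply: measurable_funM.
  by apply: (measurableT_comp (schwartz_measurable su)); exact: measurable_fun_pair.
apply: measurableT_comp; first by apply: continuous_measurable_fun; exact: continuous_cos.
apply: measurable_funD => //; apply: measurable_funM => //.
by apply: measurable_funD; exact: measurable_funM.
Qed.

(** Converts the phase that Poisson summation attaches to a translated spatial lattice into the
    signs carried by the odd rows. *)
Lemma oscillatory_shift C u xi eta theta (k : int) : dom2 C u ->
  oscillatory u xi eta (theta - pi * k%:~R) = cos (pi * k%:~R) * oscillatory u xi eta theta.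
Proof.
move=> uC; have d := dom2_wave xi eta theta uC.
rewrite /oscillatory -(IntZ _ (Int1_dom d)); congr Int; apply/funext => y.
rewrite /Int1 -(IntZ _ (dom2_section y d)); congr Int; apply/funext => x.
by rewrite /wave addrA cosB sin_int mulr0 addr0; ring.
Qed.
End fourier_transform.

(** * Irrationality of the square root of 2 *)

Section irrational.
Context {R : realType}.

(** In [2 x ^ 2 = y ^ 2] with [x] nonzero, the exponent of 2 would be odd on the left and even on
    the right. *)
Lemma sqrt2_int (x y : int) : Num.sqrt 2 * x%:~R = y%:~R :> R -> x = 0.
Proof.
move=> /(congr1 (fun z => z ^+ 2)); rewrite exprMn sqr_sqrtr// -!rmorphXn -[2]/(2%:~R) -intrM.
move=> /intr_inj xy.
have {xy} xy : (2 * absz x ^ 2 = absz y ^ 2)%N by lia.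
apply: contrapT => x0.
have ax : (0 < absz x)%N by lia.
have ay : (0 < absz y)%N by rewrite -(@ltn_exp2r 0 _ 2)// -xy; lia.
have := congr1 (logn 2) xy; rewrite lognM ?expn_gt0 ?ax// !lognX.
by rewrite (pfactorK 1)//; lia.
Qed.
End irrational.

(** * Finite unions of translates of a lattice *)

Section lattice.
Context {R : realType}.

Lemma translates_pigeonhole (L : set (R * R)) (s : seq (R * R)) (z : nat -> R * R) :
  (forall n, translates L s (z n)) ->
  exists m n l l', [/\ (m < n)%N, L l, L l' & z n - z m = l - l'].
Proof.
move=> zL.
have zL' n : exists a, a \in s /\ exists2 l, L l & z n = l + a.
  by have [a as_ lP] := zL n; exists a.
have [g gP] := choice zL'.
have [ug|] := boolP (uniq [seq g i | i <- iota 0 (size s).+1]).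
  have := uniq_leq_size (s2 := s) ug; rewrite size_map size_iota ltnn => h.
  have : {subset [seq g i | i <- iota 0 (size s).+1] <= s}.
    by move=> _ /mapP[i _ ->]; have [] := gP i.
  by move/h.
move=> /(uniqPn 0)[i [j [ij]]]; rewrite size_map size_iota => js.
rewrite !(nth_map 0%N) ?size_iota ?(ltn_trans ij)// !nth_iota ?(ltn_trans ij)// !add0n => gij.
have [_ [l Ll zi]] := gP i; have [_ [l' Ll' zj]] := gP j.
exists i, j, l', l; split => //.
by rewrite zi zj gij opprD addrACA subrr addr0.
Qed.

Lemma lattice_sub (L : set (R * R)) : full_rank_lattice L ->
  forall l l', L l -> L l' -> L (l - l').
Proof.
move=> [A [_ ->]] _ _ [_ [m [n ->]] <-] [_ [m' [n' ->]] <-].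
exists ((m - m')%:~R, (n - n')%:~R); first by exists (m - m'), (n - n').
by rewrite -linearB/=; congr (A _); rewrite !intrB.
Qed.

Lemma no_lattice (L : set (R * R)) (s : seq (R * R)) (y : R) : full_rank_lattice L ->
  (forall m : nat, translates L s (m%:R, 0)) ->
  (forall m : nat, translates L s (Num.sqrt 2 * m%:R, y)) -> False.
Proof.
move=> fL h1 h2; have subL := lattice_sub fL; have [A [Ainj LA]] := fL.
have [m [n [l [l' [mn Ll Ll' E]]]]] := translates_pigeonhole h1.
have [m' [n' [k [k' [mn' Lk Lk' E']]]]] := translates_pigeonhole h2.
have := subL _ _ Ll Ll'; rewrite -E LA => -[_ [x1 [x2 ->]] Ax].
have := subL _ _ Lk Lk'; rewrite -E' LA => -[_ [y1 [y2 ->]] Ay].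
pose d : R := (n - m)%:R; pose d' : R := (n' - m')%:R.
have d0 : d != 0 by rewrite pnatr_eq0; lia.
have Ed : (n%:R, 0) - (m%:R, 0) = (d, 0) :> R * R.
  by congr (_, _) => /=; rewrite ?subrr// /d natrB// ltnW.
have Ed' : (Num.sqrt 2 * n'%:R, y) - (Num.sqrt 2 * m'%:R, y) = (Num.sqrt 2 * d', 0) :> R * R.
  by congr (_, _) => /=; rewrite ?subrr// -mulrBr /d' natrB// ltnW.
(* The two lattice vectors are horizontal, hence proportional. Injectivity of [A] pulls the relation
   back to integer vectors, where each coordinate is an instance of [sqrt2_int]; so the first vector
   is 0, against [d != 0]. *)
have key : (Num.sqrt 2 * d') *: ((x1%:~R, x2%:~R) : R * R) = d *: ((y1%:~R, y2%:~R) : R * R).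
  apply: Ainj; rewrite !linearZ/= Ax Ay Ed Ed'.
  by congr (_, _) => /=; rewrite ?scaler0//; rewrite -![_ *: _]/(_ * _) mulrC.
have eq0 (a b : int) : Num.sqrt 2 * d' * a%:~R = d * b%:~R -> a = 0.
  rewrite -[d]/((n - m)%N%:~R) -[d']/((n' - m')%N%:~R) -mulrA -!intrM => /sqrt2_int/eqP.
  by rewrite mulf_eq0 => /orP[|/eqP//]; lia.
have x10 : x1 = 0 by apply: (eq0 _ y1); case: key.
have x20 : x2 = 0 by apply: (eq0 _ y2); case: key.
move: Ax; rewrite x10 x20 Ed (_ : (0%:~R, 0%:~R) = 0)// linear0 => -[] /esym/eqP.
by apply/negP.
Qed.
End lattice.

(** * The counterexample *)

Section counterexample.
Context {R : realType}.
Notation mR := (measurableTypeR R).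
Notation sqrt2 := (Num.sqrt 2 : R).

Lemma sqrt2_ge1 : 1 <= sqrt2.
Proof. by rewrite -{1}sqrtr1 ler_wsqrtr// ler1n. Qed.

Lemma sqrt2_sqr : sqrt2 * sqrt2 = 2.
Proof. by rewrite -expr2 sqr_sqrtr. Qed.

Lemma sqrt2V_ge : 2^-1 <= sqrt2^-1.
Proof.
have := sqrt2_ge1; have := sqrt2_sqr; move: sqrt2 => s ss s1.
by rewrite lef_pV2 ?posrE//; nra.
Qed.

Definition width (b : bool) : R := if b then sqrt2 else 1.
Definition dual_width (b : bool) : R := if b then sqrt2^-1 else 1.

Lemma width_ge1 b : 1 <= width b.
Proof. by case: b; rewrite /width// sqrt2_ge1. Qed.

Lemma dual_width_ge b : 2^-1 <= dual_width b.
Proof. by case: b; rewrite /dual_width ?sqrt2V_ge// invf_le1// ler1n. Qed.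

Definition point := grid width 2.
Definition dual_point := grid dual_width 2^-1.

(* [cos (pi * n)] is the sign [(-1) ^ n]. *)
Definition coefficient (t : site) : R[i] :=
  if t.1.1 then (cos (pi * t.2%:~R))%:C%C else 1.

(** The reciprocal covolumes are [1 / 2] and [1 / (2 sqrt 2)]. Translation by [(0, 1)] contributes
    the factor [exp (- 2 pi i y)], which at height [y = n / 2 + 1 / 4] equals [- i (-1) ^ n]. *)
Definition dual_coefficient (t : site) : R[i] :=
  if t.1.1 then (0 +i* (- cos (pi * t.2%:~R) / (sqrt2 * 2)))%C else (2^-1)%:C%C.

Lemma normc_real (x : R) : Normc.normc x%:C%C = `|x|.
Proof. by rewrite /= expr0n addr0 sqrtr_sqr. Qed.

Lemma normc_imag (x : R) : Normc.normc (0 +i* x)%C = `|x|.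
Proof. by rewrite /= expr0n add0r sqrtr_sqr. Qed.

Lemma normc_coefficient t : Normc.normc (coefficient t) = 1.
Proof.
by rewrite /coefficient; case: ifP => _; [rewrite normc_real cos_int|rewrite Normc.normc1].
Qed.

Lemma normc_dual_coefficient t : 0 < Normc.normc (dual_coefficient t) <= 1.
Proof.
have s1 := sqrt2_ge1; have s0 : 0 < sqrt2 * 2 by nra.
rewrite /dual_coefficient; case: ifP => _.
  rewrite normc_imag normrM normrN cos_int mul1r normfV gtr0_norm// invr_gt0 s0/=.
  by rewrite invf_le1//; nra.
by rewrite normc_real gtr0_norm// invr_gt0 ltr0n/= invf_le1// ler1n.
Qed.

Lemma coefficient_neq0 t : coefficient t != 0.
Proof.
apply/eqP => /(congr1 (@Normc.normc _)) /eqP.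
by rewrite normc_coefficient Normc.normc0 oner_eq0.
Qed.

Let a1 : 0 < 1 :> R. Proof. by []. Qed.
Let a2 : 1 <= 2 :> R. Proof. by rewrite ler1n. Qed.
Let h0 : 0 < 2^-1 :> R. Proof. by rewrite invr_gt0. Qed.

Definition counterexample : complex_measure R :=
  discrete_measure (grid_locally_finite a1 width_ge1 a2) coefficient.

Definition dual_counterexample : complex_measure R :=
  discrete_measure (grid_locally_finite h0 dual_width_ge (lexx _)) dual_coefficient.

Lemma Re_sum T (r : seq T) (F : T -> R[i]) :
  complex.Re (\sum_(t <- r) F t) = \sum_(t <- r) complex.Re (F t).
Proof. by rewrite (big_morph (@complex.Re R) (id1 := 0) (op1 := +%R))// => -[? ?] []. Qed.

Lemma Im_sum T (r : seq T) (F : T -> R[i]) :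
  complex.Im (\sum_(t <- r) F t) = \sum_(t <- r) complex.Im (F t).
Proof. by rewrite (big_morph (@complex.Im R) (id1 := 0) (op1 := +%R))// => -[? ?] []. Qed.

(** Shaped after [fourierE]: [f] and [g] come from the real and imaginary parts of the test
    function, and [s] is [-1] for the real part of the transform and [1] for its imaginary part. *)
Lemma sum_box_cvg (h : site -> R) (f g f' g' : int -> int -> R) (s a b a' b' : R) :
  (forall m n, h ((false, m), n) = f m n + s * g m n) ->
  (forall m n, h ((true, m), n) = f' m n + s * g' m n) ->
  symsum N (fun m => symsum N (f m)) @[N --> \oo] --> a ->
  symsum N (fun m => symsum N (g m)) @[N --> \oo] --> b ->
  symsum N (fun m => symsum N (f' m)) @[N --> \oo] --> a' ->
  symsum N (fun m => symsum N (g' m)) @[N --> \oo] --> b' ->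
  \sum_(t <- box N) h t @[N --> \oo] --> a + s * b + (a' + s * b').
Proof.
move=> h0f h1f fa gb fa' gb'.
have rows (F G H : int -> int -> R) N : (forall m n, F m n = G m n + s * H m n) ->
    symsum N (fun m => symsum N (G m)) + s * symsum N (fun m => symsum N (H m)) =
    symsum N (fun m => symsum N (F m)).
  move=> FGH; rewrite -symsumZ -symsumD; apply: eq_symsum => m.
  by rewrite -symsumZ -symsumD; apply: eq_symsum => n; rewrite FGH.
have scale (u : nat -> R) (l : R) : u N @[N --> \oo] --> l -> s * u N @[N --> \oo] --> s * l.
  by move=> ul; apply: cvgM; [exact: cvg_cst|exact: ul].
apply: eq_cvgn (cvgD (cvgD fa (scale _ _ gb)) (cvgD fa' (scale _ _ gb'))) => N.
rewrite sum_box -(rows (fun m n => h ((false, m), n)) f g)//.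
by rewrite -(rows (fun m n => h ((true, m), n)) f' g').
Qed.

Lemma even_rows u theta : schwartz_real u -> exists r : R,
  symsum N (fun m => symsum N (fun n => oscillatory u
    (point ((false, m), n)).1 (point ((false, m), n)).2 theta)) @[N --> \oo] --> r /\
  symsum N (fun m => symsum N (fun n => u (dual_point ((false, m), n)) *
    (cos theta / 2))) @[N --> \oo] --> r.
Proof.
move=> su.
have [l|r [h1 h2]] := @poisson R u 1 2 0 0 theta su (lexx 1) a2.
  by rewrite addr0 normrM ler_peMl// ger0_norm.
exists r; split.
  apply: eq_cvgn h1 => N; apply: eq_symsum => m; apply: eq_symsum => n.
  by rewrite /point /grid/= /width mulr0 mul0r subr0 mul0r !addr0.
apply: eq_cvgn h2 => N; rewrite mul1r -symsumZr; apply: eq_symsum => m.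
rewrite -symsumZr; apply: eq_symsum => n.
rewrite mulr0 mul0r add0r -mulrA; congr (u (_, _) * _).
- by rewrite /= /dual_width divr1 mul1r.
- by rewrite /= mul0r addr0 mulrC.
- by rewrite add0r.
Qed.

(** In [poisson], [c = 1] puts the frequencies at heights [2 n + 1], and [t = 1 / 4] produces the
    phase [pi * n], which is the sign of the row. *)
Lemma odd_rows u theta : schwartz_real u -> exists r : R,
  symsum N (fun m => symsum N (fun n => cos (pi * n%:~R) * oscillatory u
    (point ((true, m), n)).1 (point ((true, m), n)).2 theta)) @[N --> \oo] --> r /\
  symsum N (fun m => symsum N (fun n => u (dual_point ((true, m), n)) *
    (cos (pi * n%:~R) * - sin theta / (sqrt2 * 2)))) @[N --> \oo] --> r.
Proof.
move=> su; have [C uC] := schwartz_dom2 su.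
have [l|r [h1 h2]] := @poisson R u sqrt2 2 4^-1 1 theta su sqrt2_ge1 a2.
  rewrite (_ : 2 * l%:~R + 1 = (2 * l + 1)%:~R) -?intr_norm ?ler_int; first lia.
  by rewrite intrD intrM.
exists r; split.
  apply: eq_cvgn h1 => N; apply: eq_symsum => m; apply: eq_symsum => n.
  rewrite (_ : theta - _ = theta - pi * n%:~R); last by field.
  have -> : point ((true, m), n) = (sqrt2 * m%:~R, 2 * n%:~R + 1).
    by congr (_, _) => //; rewrite /=; field.
  exact: oscillatory_shift uC.
apply: eq_cvgn h2 => N; rewrite -symsumZr; apply: eq_symsum => m.
rewrite -symsumZr; apply: eq_symsum => n.
rewrite -mulrA; congr (u (_, _) * _).
- by rewrite /= /dual_width mulrC.
- by rewrite /=; field.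
- congr (_ / _).
  (* At height [1 / 4 + n / 2] the modulation is shifted by a quarter period; this is where the
     sine, and hence the imaginary dual masses, come from. *)
  rewrite (_ : _ + theta = pi * n%:~R + theta + pi / 2); last by field.
  by rewrite cosDpihalf sinD sin_int mul0r add0r mulrN.
Qed.

(** Transfers decay at the points to decay in their indices. The bound [sqrt2^-1] is the smallest
    width occurring on either side; 16 is 2 for the columns times 8 for the rows, which absorbs the
    offset [b / 2]. *)
Lemma grid_weight al be b m n : sqrt2^-1 <= al b -> 2^-1 <= be ->
  weight (grid al be ((b, m), n)).1 * weight (grid al be ((b, m), n)).2 <=
  16 * (weight m%:~R * weight n%:~R).
Proof.
move=> alb be2; rewrite /grid/=.
have w1 : weight (al b * m%:~R) <= 2 * weight (m%:~R : R).
  apply: weight_le => //; rewrite exprMn.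
  have : 2^-1 <= al b ^+ 2.
    rewrite (_ : 2^-1 = sqrt2^-1 ^+ 2); last by rewrite exprVn sqr_sqrtr.
    by rewrite lerXn2r// nnegrE ?invr_ge0 ?sqrtr_ge0// (le_trans _ alb)// invr_ge0 sqrtr_ge0.
  by have := sqr_ge0 (m%:~R : R); nra.
have w2 : weight (be * (n%:~R + (b : nat)%:R / 2)) <= 8 * weight (n%:~R : R).
  apply: weight_le => //; rewrite exprMn.
  have : 4^-1 <= be ^+ 2 by nra.
  have : ((b : nat)%:R = 0 :> R) \/ ((b : nat)%:R = 1 :> R) by case: (b); [right|left].
  move: (n%:~R : R) ((b : nat)%:R : R) (be ^+ 2) => x y q y01 q4.
  have : 4^-1 * (x + y / 2) ^+ 2 <= q * (x + y / 2) ^+ 2 by rewrite ler_wpM2r// sqr_ge0.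
  by move: (q * _) => z; have := sqr_ge0 (x + 1); case: y01 => ->; nra.
rewrite (_ : 16 * _ = (2 * weight (m%:~R : R)) * (8 * weight (n%:~R : R))); last by ring.
by apply: ler_pM => //; exact: weight_ge0.
Qed.

Lemma normc_le (z : R[i]) : Normc.normc z <= `|complex.Re z| + `|complex.Im z|.
Proof.
case: z => x y /=; rewrite -[leRHS]ger0_norm ?addr_ge0// -sqrtr_sqr ler_wsqrtr//.
rewrite -[x ^+ 2]real_normK ?num_real// -[y ^+ 2]real_normK ?num_real//.
have := normr_ge0 x; have := normr_ge0 y; nra.
Qed.

Lemma sum_box_bounded al be (c : site -> R[i]) (h : R * R -> R[i]) E :
  (forall b, sqrt2^-1 <= al b) -> 2^-1 <= be -> 0 <= E ->
  (forall t, Normc.normc (c t) <= 1) ->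
  (forall z, Normc.normc (h z) <= E * (weight z.1 * weight z.2)) ->
  exists C, forall N, \sum_(t <- box N) Normc.normc (c t) * Normc.normc (h (grid al be t)) <= C.
Proof.
move=> al2 be2 E0 c1 hE; have [B B0 sB] := @sum_box_weight R.
exists (E * 16 * B) => N; apply: sB; first by rewrite mulr_ge0.
move=> b m n; rewrite (le_trans (ler_piMl _ (c1 _))) ?normc_ge0//.
rewrite (le_trans (hE _))// -mulrA ler_wpM2l//.
exact: grid_weight.
Qed.

(** Both integrals are limits of sums over the same boxes, and the row lemmas give these sums equal
    limits; uniqueness of limits concludes, separately for real and imaginary parts. *)
Lemma fourier_counterexample :
  given_by (fourier_distribution (distribution_of counterexample)) dual_counterexample.
Proof.
split.
  by apply: grid_slowly_increasing => t; have /andP[] := normc_dual_coefficient t.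
move=> f sf; have [su sv] := sf.
rewrite /fourier_distribution /distribution_of.
set u := @complex.Re R \o f in su *; set v := @complex.Im R \o f in sv *.
have [Cu uC] := schwartz_dom2 su; have [Cv vC] := schwartz_dom2 sv.
have [Eu Eu0 hEu] := oscillatory_decay su; have [Ev Ev0 hEv] := oscillatory_decay sv.
have Cu0 := dom2_ge0 uC; have Cv0 := dom2_ge0 vC.
have w2 b : sqrt2^-1 <= width b.
  by rewrite (le_trans _ (width_ge1 b))// invf_le1 ?sqrt2_ge1// (lt_le_trans _ sqrt2_ge1).
have dw2 b : sqrt2^-1 <= dual_width b.
  by case: b => //; rewrite /dual_width invf_le1 ?sqrt2_ge1// (lt_le_trans _ sqrt2_ge1).
have bF z : Normc.normc (fourier f z) <= 2 * (Eu + Ev) * (weight z.1 * weight z.2).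
  rewrite (fourierE z sf) (le_trans (normc_le _))//=.
  have hu t := hEu z.1 z.2 t; have hv t := hEv z.1 z.2 t.
  rewrite (le_trans (lerD (ler_normB _ _) (ler_normD _ _)))//.
  rewrite (le_trans (lerD (lerD (hu _) (hv _)) (lerD (hu _) (hv _))))//.
  by rewrite le_eqVlt; apply/orP; left; apply/eqP; ring.
have bf z : Normc.normc (f z) <= (Cu + Cv) * (weight z.1 * weight z.2).
  rewrite (le_trans (normc_le _))// mulrDl lerD//; case: z => x y.
    exact: uC.2.
  exact: vC.2.
have E0 : 0 <= 2 * (Eu + Ev) by rewrite mulr_ge0// addr_ge0.
have h12 : 2^-1 <= 2 :> R by lra.
have cle t : Normc.normc (coefficient t) <= 1 by rewrite normc_coefficient.
have dle t : Normc.normc (dual_coefficient t) <= 1.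
  by have /andP[] := normc_dual_coefficient t.
have [C1 hC1] := sum_box_bounded w2 h12 E0 cle bF.
have [C2 hC2] := sum_box_bounded dw2 (lexx _) (addr_ge0 Cu0 Cv0) dle bf.
have mRe : measurable_fun setT ((@complex.Re R \o fourier f) : plane R -> mR).
  rewrite (_ : _ \o _ = fun y => oscillatory u y.1 y.2 0 - oscillatory v y.1 y.2 (pi / 2)).
    by apply: measurable_funB; exact: measurable_oscillatory.
  by apply/funext => y; rewrite /comp fourierE.
have mIm : measurable_fun setT ((@complex.Im R \o fourier f) : plane R -> mR).
  rewrite (_ : _ \o _ = fun y => oscillatory u y.1 y.2 (pi / 2) + oscillatory v y.1 y.2 0).
    by apply: measurable_funD; exact: measurable_oscillatory.
  by apply/funext => y; rewrite /comp fourierE.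
have [lRe lIm] := integral_discrete_cvg (grid_inj a1 width_ge1 a2) uniq_box box_mono
  box_cover (grid_locally_finite a1 width_ge1 a2) mRe mIm hC1.
have [rRe rIm] := integral_discrete_cvg (grid_inj h0 dual_width_ge (lexx _)) uniq_box box_mono
  box_cover (grid_locally_finite h0 dual_width_ge (lexx _))
  (schwartz_measurable su) (schwartz_measurable sv) hC2.
(* Even rows give the [e], odd rows the [d]. Indices 1 and 2 make up the real part of the transform
   and 3 and 4 its imaginary part, with the phases prescribed by [fourierE]. *)
have [e1 [e1l e1r]] := even_rows 0 su; have [e2 [e2l e2r]] := even_rows (pi / 2) sv.
have [e3 [e3l e3r]] := even_rows (pi / 2) su; have [e4 [e4l e4r]] := even_rows 0 sv.
have [d1 [d1l d1r]] := odd_rows 0 su; have [d2 [d2l d2r]] := odd_rows (pi / 2) sv.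
have [d3 [d3l d3r]] := odd_rows (pi / 2) su; have [d4 [d4l d4r]] := odd_rows 0 sv.
apply/eqP; rewrite eq_complex; apply/andP; split; apply/eqP.
- transitivity (e1 + (- 1) * e2 + (d1 + (- 1) * d2)).
    rewrite -(cvg_lim _ lRe)//; apply/cvg_lim => //.
    apply: eq_cvgn (sum_box_cvg (h := fun t => complex.Re (coefficient t * fourier f (point t)))
      _ _ e1l e2l d1l d2l) => [N|m n|m n].
    - by rewrite Re_sum.
    - by rewrite /coefficient fourierE// mul1r mulN1r.
    - by rewrite /coefficient fourierE//= mul0r subr0 mulrBr mulN1r.
  rewrite -(cvg_lim _ rRe)//; apply/esym/cvg_lim => //.
  apply: eq_cvgn (sum_box_cvg (h := fun t => complex.Re (dual_coefficient t * f (dual_point t)))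
      _ _ e1r e2r d1r d2r) => [N|m n|m n].
  - by rewrite Re_sum.
  - rewrite /dual_coefficient/= cos0 cos_pihalf /u /v /dual_point /=.
    by case: (f _) => x y /=; ring.
  - rewrite /dual_coefficient/= sin0 sin_pihalf /u /v /dual_point /=.
    by case: (f _) => x y /=; ring.
- transitivity (e3 + 1 * e4 + (d3 + 1 * d4)).
    rewrite -(cvg_lim _ lIm)//; apply/cvg_lim => //.
    apply: eq_cvgn (sum_box_cvg (h := fun t => complex.Im (coefficient t * fourier f (point t)))
      _ _ e3l e4l d3l d4l) => [N|m n|m n].
    - by rewrite Im_sum.
    - by rewrite /coefficient fourierE// !mul1r.
    - by rewrite /coefficient fourierE//= mul0r addr0 mulrDr mul1r.
  rewrite -(cvg_lim _ rIm)//; apply/esym/cvg_lim => //.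
  apply: eq_cvgn (sum_box_cvg (h := fun t => complex.Im (dual_coefficient t * f (dual_point t)))
      _ _ e3r e4r d3r d4r) => [N|m n|m n].
  - by rewrite Im_sum.
  - rewrite /dual_coefficient/= cos0 cos_pihalf /u /v /dual_point /=.
    by case: (f _) => x y /=; ring.
  - rewrite /dual_coefficient/= sin0 sin_pihalf /u /v /dual_point /=.
    by case: (f _) => x y /=; ring.
Qed.

Lemma uniformly_discrete_supp (A B : set (R * R)) : A `<=` B ->
  uniformly_discrete B -> uniformly_discrete A.
Proof. by move=> AB [g g0 Bg]; exists g => // x y /AB Bx /AB; exact: Bg. Qed.

Lemma uniformly_discrete_grid al be a0 : 0 < a0 -> (forall b, a0 <= al b) -> a0 <= be ->
  uniformly_discrete (range (@grid R al be)).
Proof.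
move=> a00 a0al a0be; exists (a0 / 2); first by rewrite divr_gt0.
move=> _ _ [u _ <-] [t _ <-] ut; apply: grid_separated => // e.
by apply: ut; rewrite e.
Qed.

End counterexample.

Theorem mainTheorem1 (R : realType) :
  exists mu : complex_measure R,
    [/\ slowly_increasing mu,
        uniformly_discrete (supp mu),
        exists nu : complex_measure R,
          given_by (fourier_distribution (distribution_of mu)) nu /\
          uniformly_discrete (supp nu) &
        ~ exists (L : set (R * R)) (a : seq (R * R)),
            full_rank_lattice L /\ supp mu `<=` translates L a].
Proof.
have a1 : 0 < 1 :> R by [].
have a2 : 1 <= 2 :> R by rewrite ler1n.
have h0 : 0 < 2^-1 :> R by rewrite invr_gt0.
exists (counterexample (R := R)); split.
- by apply: grid_slowly_increasing => t; rewrite normc_coefficient.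
- apply: uniformly_discrete_supp (uniformly_discrete_grid a1 (@width_ge1 R) a2).
  apply: (@discrete_supp_sub _ _ _ _ _ (1 / 2)); first by rewrite divr_gt0.
  by move=> u t; exact: (grid_separated a1 (@width_ge1 R) a2).
- exists (dual_counterexample (R := R)); split; first exact: fourier_counterexample.
  apply: uniformly_discrete_supp (uniformly_discrete_grid h0 (@dual_width_ge R) (lexx _)).
  apply: (@discrete_supp_sub _ _ _ _ _ (2^-1 / 2)); first by rewrite divr_gt0.
  by move=> u t; exact: (grid_separated h0 (@dual_width_ge R) (lexx _)).
move=> [L [a [fL sL]]].
have sub : range (point (R := R)) `<=` translates L a.
  apply: subset_trans sL; apply: discrete_supp_sup; first exact: grid_inj a1 (@width_ge1 R) a2.
  exact: coefficient_neq0.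
apply: (@no_lattice R L a 1 fL) => m.
- have := sub (point ((false, m%:Z), 0)) (ex_intro2 _ _ _ I erefl).
  by rewrite /point /grid/= /width mul1r mul0r addr0 mulr0.
- have := sub (point ((true, m%:Z), 0)) (ex_intro2 _ _ _ I erefl).
  by rewrite /point /grid/= /width add0r mul1r mulfV.
Qed.
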